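(* Let $\varepsilon>0$ be arbitrarily small and let $G\in\mathcal G(n,r,2)$ with $r^2=(1+\varepsilon)\log n/\pi$. Then a.a.s., for any two vertices $x,y$ of $G$, $\mathcal R(x\longleftrightarrow y)=O(1/\log n)$.
   Context: Random geometric graph: $\mathcal G(n,r,2)$ has as vertex set a Poisson point process of intensity $1$ on $\Lambda_n=[-\sqrt n/2,\sqrt n/2]^2$, two vertices adjacent iff at Euclidean distance $\le r$; a.a.s. means with probability tending to $1$ as $n\to\infty$. Effective resistance: for a finite connected graph with unit edge resistances, $\mathcal R(x\longleftrightarrow y)$ is the infimum, over unit flows $\theta$ from $x$ to $y$ (antisymmetric functions on oriented edges with net outflow $1$ at $x$, net inflow $1$ at $y$, conserved elsewhere), of the energy $\sum_e\theta(e)^2$. *)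

(* Defs.v *)
From HB Require Import structures.
From mathcomp Require Import all_boot all_order all_algebra.
From mathcomp Require Import all_classical all_reals all_analysis.
Set Implicit Arguments.
Unset Strict Implicit.
Unset Printing Implicit Defensive.
Import Order.TTheory GRing.Theory Num.Theory.
Import numFieldNormedType.Exports.
Local Open Scope classical_set_scope.
Local Open Scope ring_scope.

Section RGG.
Context {R : realType}.

Definition Lambda (n : nat) : set (R * R) :=
  [set p | -(Num.sqrt n%:R / 2) <= p.1 <= Num.sqrt n%:R / 2 /\
           -(Num.sqrt n%:R / 2) <= p.2 <= Num.sqrt n%:R / 2].

Definition leb2 := ((@lebesgue_measure R) \x (@lebesgue_measure R))%E.

(* Poisson pmf with the convention that rate 0 is the Dirac mass at 0. *)
Definition ppmf (rate : R) (k : nat) : R :=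
  rate ^+ k / (k`!)%:R * expR (- rate).

Definition count_in (A : set (R * R)) (s : seq (R * R)) : nat :=
  count (fun p => `[< A p >]) s.

Definition is_PPP (d : measure_display) (Omega : measurableType d)
    (P : probability Omega R) (n : nat) (X : Omega -> seq (R * R)) : Prop :=
  [/\ forall w, uniq (X w) /\ (forall p, p \in X w -> Lambda n p),
      forall (A : set (R * R)) (k : nat), measurable A ->
        measurable [set w | count_in A (X w) = k] &
      forall (m : nat) (A : 'I_m -> set (R * R)) (k : 'I_m -> nat),
        (forall i, measurable (A i)) ->
        (forall i, A i `<=` Lambda n) ->
        (forall i j, i != j -> A i `&` A j = set0) ->
        P (\bigcap_(i in [set: 'I_m]) [set w | count_in (A i) (X w) = k i])
          = (\prod_(i < m) ppmf (fine (leb2 (A i))) (k i))%:E].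

Definition adj (r : R) (p q : R * R) : bool :=
  (p != q) && (Num.sqrt ((p.1 - q.1) ^+ 2 + (p.2 - q.2) ^+ 2) <= r).

Definition unit_flow (V : seq (R * R)) (r : R) (x y : R * R)
    (theta : R * R -> R * R -> R) : Prop :=
  [/\ forall u v, theta u v = - theta v u,
      forall u v, ~~ [&& u \in V, v \in V & adj r u v] -> theta u v = 0 &
      forall u, u \in V ->
        \sum_(v <- V) theta u v = (u == x)%:R - (u == y)%:R].

(* energy: sum over unoriented edges of theta(e)^2 (each edge counted twice
   in the double sum, hence the factor 1/2). *)
Definition energy (V : seq (R * R)) (theta : R * R -> R * R -> R) : R :=
  2^-1 * \sum_(u <- V) \sum_(v <- V) theta u v ^+ 2.

(* effective resistance, infimum in the extended reals (+oo if no flow) *)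
Definition effres (V : seq (R * R)) (r : R) (x y : R * R) : \bar R :=
  ereal_inf [set (energy V theta)%:E | theta in [set theta | unit_flow V r x y theta]].

Definition rgg_radius (eps : R) (n : nat) : R :=
  Num.sqrt ((1 + eps) * ln n%:R / pi).

End RGG.

(* Main.v *)
Require Import Defs.
From HB Require Import structures.
From mathcomp Require Import all_boot all_order all_algebra.
From mathcomp Require Import all_classical all_reals all_analysis.
From mathcomp Require Import zify ring lra.

(** Tile the square by cells of side slightly below [r / q], [q] large, and call
    a cell good if it holds at least a small multiple of [log n] points. A cell
    is bad with probability [n^(-a + o(1))] where [a log n] is its area, so with
    high probability the bad cells in a window of bounded size cover area less
    than that of a disc of radius [r], less than that of a half disc if the
    window meets one side of the square, and there is none near a corner. A
    cluster of good cells missing the good rows and columns of its window would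
    have only bad cells in the half discs beyond its extremal cells, which is too
    many: so good cells are locally connected, and the grid of cells embeds into
    the good cells with bounded distortion and overlap. A grid edge costs energy
    [O(1 / log^2 n)] since a flow between two good cells spreads over
    [log^2 n] edges, Polya's urn gives grid flows of energy [O(log n)], and the
    first and last step from or to a single vertex cost [O(1 / log n)]. *)

Import Order.TTheory GRing.Theory Num.Theory.
Import numFieldNormedType.Exports.
Local Open Scope classical_set_scope.
Local Open Scope ring_scope.

Set Implicit Arguments.
Unset Strict Implicit.
Unset Printing Implicit Defensive.

(** * Local connectivity of the good cells *)

(** A disc of radius [r] contains about [4 * qcount] cells, of total area about (1 + eps) log n.
    Hence [4 * qcount] bad cells in a given window have probability about n^(-(1 + eps)), up to the
    losses made in discretising, and this beats the at most n windows. Along the sides there are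
    only of order sqrt n windows, so half as many bad cells are already too many; at the corners the
    number of windows is bounded and one bad cell is too many. The obstacle is that a cluster may
    leave the window before its extremal cell is reached, and then no half disc is under control.
    Lines without bad cells serve as barriers: a band has more lines than the window has bad cells,
    so one of them is free, and a cluster that misses the free lines stays where its half discs fit
    in the window. All free rows and columns cross, hence a cluster that meets one of them is joined
    to every other such cluster. Connecting inside windows, and not merely in the whole graph, keeps
    the detours bounded by a constant that depends on eps alone. The grid then contributes log n /
    log^2 n, the same order as the two end vertices. *)

Section GoodCells.
Local Open Scope nat_scope.
Variables (q M m : nat).

Definition dn (i j : nat) : nat := (i - j) + (j - i).

(** One is added to each offset because points of cells at offset [i] can differ by [i + 1] cell
    sides: all pairs of points of the two cells are then within [q] sides. *)
Definition close (x y x' y' : nat) : bool :=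
  (dn x x').+1 ^ 2 + (dn y y').+1 ^ 2 <= q ^ 2.

Lemma close_dn x y x' y' : close x y x' y' -> dn x x' < q /\ dn y y' < q.
Proof. rewrite /close; nia. Qed.

Lemma close_sym x y x' y' : close x y x' y' = close x' y' x y.
Proof. by rewrite /close /dn [x - x' + _]addnC [y - y' + _]addnC. Qed.

Lemma close_le x y x' y' z w :
  dn x z <= dn x x' -> dn y w <= dn y y' -> close x y x' y' -> close x y z w.
Proof.
rewrite /close => h1 h2; apply: leq_trans.
by apply: leq_add; rewrite leq_exp2r.
Qed.

Definition cadj (s t : 'I_m * 'I_m) : bool := close s.1 s.2 t.1 t.2.

Definition win (a t : 'I_m * 'I_m) : bool := (dn a.1 t.1 <= M) && (dn a.2 t.2 <= M).

Lemma card_win (a : 'I_m * 'I_m) : (#|[pred t | win a t]| <= (2 * M).+1 ^ 2).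
Proof.
pose f (t : 'I_m * 'I_m) : 'I_(2 * M).+1 * 'I_(2 * M).+1 :=
  (inord (t.1 + M - a.1), inord (t.2 + M - a.2)).
have -> : ((2 * M).+1 ^ 2) = #|{: 'I_(2 * M).+1 * 'I_(2 * M).+1}|.
  by rewrite card_prod card_ord -mulnn.
apply: (@fintype.leq_card_in _ _ f) => -[i j] [i' j']; rewrite !inE /win /dn /= => w w'.
have := ltn_ord i; have := ltn_ord j; have := ltn_ord i'; have := ltn_ord j' => ? ? ? ?.
case=> /(congr1 val) e1 /(congr1 val) e2; move: e1 e2; rewrite /= !inordK; try lia.
by move=> e1 e2; congr (_, _); apply: val_inj => /=; lia.
Qed.

(* Offsets, in an open quadrant, of the cells that lie entirely within [q] cell
   sides of every point of the cell at the origin. *)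
Definition qcount : nat :=
  #|[pred p : 'I_q * 'I_q | [&& 0 < p.1, 0 < p.2 & p.1.+1 ^ 2 + p.2.+1 ^ 2 <= q ^ 2]]|.

(* Coordinates obtained from the standard ones by a symmetry of the square. *)
Record frame (u v : 'I_m * 'I_m -> nat) : Prop := Frame {
  frame_u : forall t, u t < m;
  frame_v : forall t, v t < m;
  frame_mk : forall x y, x < m -> y < m -> exists t, u t = x /\ v t = y;
  frame_cadj : forall s t, cadj s t = close (u s) (v s) (u t) (v t);
  frame_win : forall a t, win a t = (dn (u a) (u t) <= M) && (dn (v a) (v t) <= M);
  frame_line : (forall s t, u s = u t <-> s.1 = t.1) \/
               (forall s t, u s = u t <-> s.2 = t.2);
  frame_line' : (forall s t, v s = v t <-> s.1 = t.1) \/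
                (forall s t, v s = v t <-> s.2 = t.2)
}.

Lemma frame0 : frame (fun t => t.1) (fun t => t.2).
Proof.
split=> //; last first.
- by right=> s t; split=> [/val_inj|->].
- by left=> s t; split=> [/val_inj|->].
by move=> x y hx hy; exists (Ordinal hx, Ordinal hy).
Qed.

Lemma frame_swap u v : frame u v -> frame v u.
Proof.
case=> hu hv mk ca wi l l'; split=> //.
- by move=> x y hx hy; have [t [? ?]] := mk y x hy hx; exists t.
- by move=> s t; rewrite ca /close addnC.
- by move=> a t; rewrite wi andbC.
Qed.

Lemma frame_flip u v : frame u v -> frame (fun t => m.-1 - u t) v.
Proof.
case=> hu hv mk ca wi l l'; split=> //.
- by move=> t; have := hu t; lia.
- move=> x y hx hy; have [|t [ut vt]] := mk (m.-1 - x) y _ hy; first by lia.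
  by exists t; split=> //; rewrite ut; lia.
- move=> s t; rewrite ca /close; have -> // : dn (m.-1 - u s) (m.-1 - u t) = dn (u s) (u t).
  by have := hu s; have := hu t; rewrite /dn; lia.
- move=> a t; rewrite wi; have -> // : dn (m.-1 - u a) (m.-1 - u t) = dn (u a) (u t).
  by have := hu a; have := hu t; rewrite /dn; lia.
- by case: l => l; [left|right] => s t; rewrite -l; have := hu s; have := hu t; lia.
Qed.

(** Each offset counted by [qcount] is used twice, upwards and downwards in [v]. The two copies are
    disjoint since the offsets avoid the axes, and the margins keep them in the grid. *)
Lemma half_disc u v p : frame u v -> u p + q < m -> q <= v p -> v p + q < m ->
  2 * qcount <= #|[pred t | cadj p t && (u p < u t)]|.
Proof.
move=> F h1 h2 h3.
pose mk x y := odflt p [pick t | (u t == x) && (v t == y)].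
have mkP x y : x < m -> y < m -> u (mk x y) = x /\ v (mk x y) = y.
  move=> hx hy; rewrite /mk; case: pickP => [t /andP[/eqP ? /eqP ?]//|].
  by have [t [e1 e2]] := frame_mk F hx hy; move=> /(_ t); rewrite e1 e2 !eqxx.
pose A := [pred p : 'I_q * 'I_q | [&& 0 < p.1, 0 < p.2 & p.1.+1 ^ 2 + p.2.+1 ^ 2 <= q ^ 2]].
pose f (x : bool * ('I_q * 'I_q)) :=
  mk (u p + x.2.1) (if x.1 then v p + x.2.2 else v p - x.2.2).
have fP x : u (f x) = u p + x.2.1 /\ v (f x) = if x.1 then v p + x.2.2 else v p - x.2.2.
  by have [? ?] := (ltn_ord x.2.1, ltn_ord x.2.2); apply: mkP; case: x.1; lia.
have := cardX (@predT bool) A; rewrite card_bool -/qcount => <-.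
rewrite -(@card_in_image _ _ f); last first.
  move=> [b [i j]] [b' [i' j']]; rewrite !inE /= => /and3P[i0 j0 _] /and3P[i0' j0' _] e.
  have [e1 e2] := fP (b, (i, j)); have [] := fP (b', (i', j')); rewrite -e e1 e2 /= => e3 e4; clear e e1 e2.
  have [? ?] := (ltn_ord j, ltn_ord j').
  have -> : i = i' by apply: val_inj => /=; lia.
  have -> : j = j' by apply: val_inj => /=; move: e4; case: b b' => -[]; lia.
  by congr (_, _); move: e4; case: b b' => -[]; lia.
apply: subset_leq_card; apply/fintype.subsetP => t /fintype.imageP[[b [i j]]]; rewrite !inE /= => /and3P[i0 j0 h] ->.
have [e1 e2] := fP (b, (i, j)); rewrite (frame_cadj F) e1 e2 /= /close; clear e1 e2.
have := ltn_ord j => jq; apply/andP; split; last by lia.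
have -> : dn (u p) (u p + i) = i by rewrite /dn; lia.
suff -> : dn (v p) (if b then v p + j else v p - j) = j by [].
by rewrite /dn; case: b; lia.
Qed.

Variable good : pred ('I_m * 'I_m).

Definition nbad (a : 'I_m * 'I_m) : nat := #|[pred t | win a t && ~~ good t]|.

(** Links are confined to the window of [a]: this later bounds both the length of paths and the
    number of flows that share an edge. *)
Definition lrel (a : 'I_m * 'I_m) : rel ('I_m * 'I_m) :=
  fun s t => [&& win a s, win a t, good s, good t & cadj s t].

Lemma lrel_csym a : connect_sym (lrel a).
Proof.
by apply: sym_connect_sym => s t; rewrite /lrel /cadj close_sym; case: (win a s); case: (win a t); case: (good s); case: (good t).
Qed.

Hypothesis q3 : 3 <= q.
(** Beyond the cells within [q.+1] of its centre, a window has room for a band of [4 * qcount] lines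
    and for a further margin of [q], the reach of a half disc. *)
Hypothesis hM : 2 * q + 4 * qcount + 2 <= M.
Hypothesis hm : 2 * M < m.

(** * Barriers and trapped clusters in one window *)

Section Window.
Variable a : 'I_m * 'I_m.
Hypothesis nb4 : nbad a < 4 * qcount.

Definition full (u : 'I_m * 'I_m -> nat) (x : nat) : Prop :=
  forall t, u t = x -> win a t -> good t.

(** Pigeonhole: bad cells on different lines are different, so [4 * qcount] lines cannot all contain
    one. *)
Lemma full_exists u v lo : frame u v ->
  (forall x, lo <= x < lo + 4 * qcount -> dn (u a) x <= M /\ x < m) ->
  exists2 x, lo <= x < lo + 4 * qcount & full u x.
Proof.
move=> F h.
pose bd (k : 'I_(4 * qcount)) := [pred t | [&& u t == lo + k, win a t & ~~ good t]].
case: (boolP [forall k, [exists t, bd k t]]) => [/forallP al|]; last first.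
  rewrite negb_forall => /existsP[k]; rewrite negb_exists => /forallP nk.
  exists (lo + k); first by have := ltn_ord k; lia.
  by move=> t ut wt; have := nk t; rewrite /= ut eqxx wt /= negbK.
pose f k := odflt a [pick t | bd k t].
have fP k : bd k (f k).
  rewrite /f; case: pickP => [t //|n0].
  by have /existsP[t bt] := al k; have := n0 t; rewrite bt.
suff : 4 * qcount <= nbad a by lia.
rewrite -[X in X <= _]card_ord -(@fintype.card_image _ _ f); last first.
  move=> k k' e; have /and3P[/eqP e1 _ _] := fP k; have /and3P[/eqP e2 _ _] := fP k'.
  by apply: val_inj => /=; rewrite e in e1; lia.
apply: subset_leq_card; apply/fintype.subsetP => t /fintype.imageP[k _ ->].
by have /and3P[_ w g] := fP k; rewrite inE w g.
Qed.

(** Consecutive cells of a line are [close] because 1 + 2 ^ 2 <= q ^ 2, by [3 <= q]. *)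
Lemma full_connect_up u v x : frame u v -> full u x -> forall d s t,
  u s = x -> u t = x -> win a s -> win a t -> v t = v s + d -> connect (lrel a) s t.
Proof.
move=> F fu; elim=> [|d IH] s t us ut ws wt e.
  have ca : cadj s t.
    rewrite (frame_cadj F) us ut e addn0 /close /dn !subnn; nia.
  by apply: connect1; rewrite /lrel ws wt ca (fu s us ws) (fu t ut wt).
have := frame_v F t; have := frame_u F s => h1 h2.
have [||y [ey1 ey2]] := frame_mk F (x := x) (y := (v s).+1); [by rewrite -us|lia|].
have wy : win a y.
  by move: ws wt; rewrite !(frame_win F) us ut ey1 ey2 /dn; lia.
apply: connect_trans (IH y t ey1 ut wy wt _); last by lia.
apply: connect1; rewrite /lrel ws wy (fu s us ws) (fu y ey1 wy) /=.
rewrite (frame_cadj F) us ey1 ey2 /close /dn; nia.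
Qed.

Lemma full_connect u v x s t : frame u v -> full u x ->
  u s = x -> u t = x -> win a s -> win a t -> connect (lrel a) s t.
Proof.
move=> F fu us ut ws wt; have [h|h] := leqP (v s) (v t).
  by apply: (full_connect_up F fu (d := v t - v s)) => //; lia.
by rewrite lrel_csym; apply: (full_connect_up F fu (d := v s - v t)) => //; lia.
Qed.

(** A cell on a row or column that is free of bad cells in the window. It is phrased by coordinates,
    not by a frame, so that barriers found in different frames give the same notion. *)
Definition anchor (t : 'I_m * 'I_m) : Prop := win a t /\
  ((forall s, s.1 = t.1 -> win a s -> good s) \/ (forall s, s.2 = t.2 -> win a s -> good s)).

Lemma full_anchor u v x t : frame u v -> full u x -> u t = x -> win a t -> anchor t.
Proof.
move=> F fu ut wt; split=> //.
by case: (frame_line F) => l; [left|right]; move=> s st ws; apply: fu => //; rewrite -ut; apply/l.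
Qed.

(** The window is a product, so it contains the crossing [(s.1, t.2)] of the column of [s] and the
    row of [t]. *)
Lemma cross_connect x y s t : full (fun t => t.1) x -> full (fun t => t.2) y ->
  val s.1 = x -> val t.2 = y -> win a s -> win a t -> connect (lrel a) s t.
Proof.
move=> fx fy sx ty ws wt; pose z := (s.1, t.2).
have wz : win a z by move: ws wt; rewrite /win /=; lia.
apply: (@connect_trans _ _ z).
  by apply: (full_connect frame0 fx).
by apply: (full_connect (frame_swap frame0) fy).
Qed.

Lemma full_exists_any u v : frame u v -> exists x, [/\ full u x, x < m & dn (u a) x <= M].
Proof.
move=> F; have ua := frame_u F a.
(* Since [2 * M < m], the window is uncut on at least one side of [a], and the band is taken
   there. *)
have [lo hlo] : exists lo, forall x, lo <= x < lo + 4 * qcount -> dn (u a) x <= M /\ x < m.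
  case: (ltnP (u a + M) m) => h.
    by exists (u a) => x; rewrite /dn; lia.
  by exists (u a - M) => x; rewrite /dn; lia.
by have [x /hlo [? ?] ?] := full_exists F hlo; exists x.
Qed.

Lemma anchor_connect s t : anchor s -> anchor t -> connect (lrel a) s t.
Proof.
have [x [fx xm xM]] := full_exists_any frame0.
have [y [fy ym yM]] := full_exists_any (frame_swap frame0).
pose z : 'I_m * 'I_m := (Ordinal xm, Ordinal ym).
have wz : win a z by rewrite /win /= xM yM.
suff h : forall s, anchor s -> connect (lrel a) s z.
  by move=> /h hs /h ht; apply: connect_trans hs _; rewrite lrel_csym.
move=> {}s [ws [l|l]].
  apply: (cross_connect (x := s.1) (y := y)) => //.
  by move=> w e ww; apply: l => //; apply: val_inj.
rewrite lrel_csym; apply: (cross_connect (x := x) (y := s.2)) => //.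
by move=> w e ww; apply: l => //; apply: val_inj.
Qed.

Lemma connect_good b t : win a b -> good b -> connect (lrel a) b t -> win a t /\ good t.
Proof.
move=> wb gb /connectP[p]; elim: p b wb gb => [|c p IH] b wb gb /=; first by move=> _ ->.
by case/andP => /and5P[_ wc _ gc _] /(IH _ wc gc).
Qed.

(* A step over a full line lands next to it, since each of its two ends is
   closer to the line than to the other end. *)
Lemma connect_barrier u v x b t : frame u v -> full u x -> dn (u a) x <= M -> x < m ->
  u b < x -> connect (lrel a) b t ->
  u t < x \/ exists2 z, anchor z & connect (lrel a) b z.
Proof.
move=> F fu hx xm + /connectP[p]; elim: p b => [|c p IH] b ub /=; first by move=> _ ->; left.
case/andP => bc; have /and5P[wb wc gb gc ca] := bc.
have [uc|uc] := ltnP (u c) x.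
  move=> /(IH _ uc) h /h[?|[z az cz]]; first by left.
  by right; exists z => //; apply: connect_trans (connect1 bc) cz.
move=> _ _; right.
have [z [uz vz]] := frame_mk F xm (frame_v F b).
have wz : win a z by move: wb; rewrite !(frame_win F) uz vz hx => /andP[].
exists z; first exact: full_anchor F fu uz wz.
apply: connect1; rewrite /lrel wb wz gb (fu z uz wz) /=.
move: ca; rewrite !(frame_cadj F) uz vz; apply: close_le; rewrite /dn; lia.
Qed.

Section Trapped.
Variable b : 'I_m * 'I_m.
Hypotheses (gb : good b) (b1 : dn a.1 b.1 <= q.+1) (b2 : dn a.2 b.2 <= q.+1).
Hypothesis noanchor : forall z, anchor z -> ~~ connect (lrel a) b z.

Lemma win_near : win a b.
Proof. by rewrite /win; lia. Qed.

(** Some line of the band that starts at [u a + q + 2] is a barrier. The cluster of [b] starts below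
    it and, having no anchor, cannot cross it; the margin [q] left above the band gives the
    bound. *)
Lemma trapped u v t : frame u v -> dn (u a) (u b) <= q.+1 -> u a + M < m ->
  connect (lrel a) b t -> u t + q <= u a + M.
Proof.
move=> F ub hu bt.
have [|x /andP[x1 x2] fx] := full_exists (lo := u a + q + 2) F; first by rewrite /dn; lia.
have [|||//|h|[z /noanchor/negP]//] := connect_barrier F fx (x := x) (b := b) (t := t).
- by rewrite /dn; lia.
- by lia.
- by move: ub; rewrite /dn; lia.
by move: h; lia.
Qed.

(** Let [p] be a cell of the cluster with [u] maximal. A good cell of the half disc beyond [p] would
    belong to the cluster and contradict maximality. The bounds of [trapped] place this half disc
    inside the window and the grid. *)
Lemma half_bad u v : frame u v -> dn (u a) (u b) <= q.+1 -> dn (v a) (v b) <= q.+1 ->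
  u a + M < m -> M <= v a -> v a + M < m ->
  exists p, [/\ connect (lrel a) b p, forall t, connect (lrel a) b t -> u t <= u p
    & 2 * qcount <= #|[pred t | (win a t && ~~ good t) && (u p < u t)]|].
Proof.
move=> F ub vb hu hv hv'.
have [p cp pmax] := @arg_maxnP _ b (connect (lrel a) b) u (connect0 _ _).
exists p; split; [exact: cp|by move=> t /pmax|].
have [wp gp] := connect_good win_near gb cp.
have t1 := trapped F ub hu cp.
have t2 := trapped (frame_swap F) vb hv' cp.
have va := frame_v F a; have vb' := frame_v F b; have vp := frame_v F p.
have t4 : q + v a <= v p + M.
  have := trapped (frame_flip (frame_swap F)) _ _ cp.
  by move: vb; rewrite /dn; lia.
have t3 : q <= v p by lia.
have e1 : u p + q < m by lia.
have e2 : v p + q < m by lia.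
apply: leq_trans (half_disc F e1 t3 e2) _.
apply: subset_leq_card; apply/fintype.subsetP => t; rewrite !inE => /andP[pt ut]; rewrite ut andbT.
have wt : win a t.
  move: pt; rewrite (frame_cadj F) => /close_dn.
  move: wp; rewrite !(frame_win F) /dn; lia.
rewrite wt; apply/negP => gt.
have : u t <= u p.
  by apply: pmax; apply: connect_trans cp (connect1 _); rewrite /lrel wp wt gp gt pt.
by lia.
Qed.

Lemma half_bad_side u v : frame u v -> dn (u a) (u b) <= q.+1 -> dn (v a) (v b) <= q.+1 ->
  u a + M < m -> M <= v a -> v a + M < m -> 2 * qcount <= nbad a.
Proof.
move=> F ub vb hu hv hv'; have [p [_ _ h]] := half_bad F ub vb hu hv hv'.
apply: leq_trans h _; apply: subset_leq_card; apply/fintype.subsetP => t; rewrite !inE.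
by case/andP.
Qed.

(** The half discs beyond the two opposite extremes of the cluster are disjoint, so together they
    exceed the number of bad cells of the window. *)
Lemma half_bad_both u v : frame u v -> dn (u a) (u b) <= q.+1 -> dn (v a) (v b) <= q.+1 ->
  M <= u a -> u a + M < m -> M <= v a -> v a + M < m -> False.
Proof.
move=> F ub vb hu hu' hv hv'; have [p [_ mp h]] := half_bad F ub vb hu' hv hv'.
have [||p' [cp' _ h']] := half_bad (frame_flip F) _ vb _ hv hv'.
- by move: ub (frame_u F a) (frame_u F b); rewrite /dn; lia.
- by move: (frame_u F a); lia.
move: h h'; set A := [pred t | _ ]; set B := [pred t | _ && (m.-1 - _ < _)] => h h'.
suff : #|A| + #|B| <= nbad a by lia.
rewrite -cardUI (_ : #|[predI A & B]| = 0) ?addn0; last first.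
  apply: eq_card0 => t; rewrite !inE /=; apply/negP.
  by have := mp _ cp'; have := frame_u F p; have := frame_u F p'; have := frame_u F t; lia.
apply: subset_leq_card; apply/fintype.subsetP => t; rewrite !inE.
by case/orP => /andP[].
Qed.

End Trapped.
End Window.

(** These cells have a window that a side of the square cuts, or touches, in the given direction. *)
Definition nearI (a : 'I_m * 'I_m) : bool := (a.1 < M) || (m <= a.1 + M).
Definition nearJ (a : 'I_m * 'I_m) : bool := (a.2 < M) || (m <= a.2 + M).

Hypothesis nb4 : forall a, nbad a < 4 * qcount.
Hypothesis nb2 : forall a, nearI a || nearJ a -> nbad a < 2 * qcount.
Hypothesis nb0 : forall a, nearI a && nearJ a -> nbad a = 0.

Lemma nbad0_good (a t : 'I_m * 'I_m) : nbad a = 0 -> win a t -> good t.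
Proof. by move/card0_eq => /(_ t); rewrite !inE => + w; rewrite w => /negbFE. Qed.

(** At a corner every cell of the window is good, so [b] itself is an anchor. Elsewhere a cluster
    without anchor is excluded by its half discs; near a side the frame is chosen so that [u] points
    away from that side. *)
Lemma to_anchor (a b : 'I_m * 'I_m) : good b -> dn a.1 b.1 <= q.+1 -> dn a.2 b.2 <= q.+1 ->
  exists2 z, anchor a z & connect (lrel a) b z.
Proof.
move=> gb h1 h2; have wb : win a b by rewrite /win; lia.
have [/andP[nI nJ]|nn] := boolP (nearI a && nearJ a).
  exists b => //; split=> //; left=> s _; apply: nbad0_good.
  by apply: nb0; rewrite nI nJ.
apply: contrapT => ex.
have na z : anchor a z -> ~~ connect (lrel a) b z.
  by move=> az; apply/negP => cz; apply: ex; exists z.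
have sd := half_bad_side (nb4 a) gb h1 h2 na.
have F := frame0; have G := frame_swap F; have Fl := frame_flip F.
have Gl := frame_flip G; have [l1 l2] := (ltn_ord a.1, ltn_ord a.2).
have [l3 l4] := (ltn_ord b.1, ltn_ord b.2).
have [nI|nI] := boolP (nearI a); have [nJ|nJ] := boolP (nearJ a).
- by rewrite nI nJ in nn.
- have := @nb2 a; rewrite nI => /(_ isT); rewrite ltnNge => /negP; apply.
  have [h|h] := ltnP a.1 M.
    by apply: (sd _ _ F) => //; move: nJ; rewrite /nearJ; lia.
  by apply: (sd _ _ Fl) => //; move: nJ nI h1; rewrite /nearJ /nearI /dn; lia.
- have := @nb2 a; rewrite nJ orbT => /(_ isT); rewrite ltnNge => /negP; apply.
  have [h|h] := ltnP a.2 M.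
    by apply: (sd _ _ G) => //; move: nI; rewrite /nearI; lia.
  by apply: (sd _ _ Gl) => //; move: nI nJ h2; rewrite /nearJ /nearI /dn; lia.
- apply: (half_bad_both (nb4 a) gb h1 h2 na F) => //;
  by move: nI nJ; rewrite /nearI /nearJ; lia.
Qed.

Lemma local_connect (a b b' : 'I_m * 'I_m) : good b -> good b' ->
  dn a.1 b.1 <= q.+1 -> dn a.2 b.2 <= q.+1 ->
  dn a.1 b'.1 <= q.+1 -> dn a.2 b'.2 <= q.+1 -> connect (lrel a) b b'.
Proof.
move=> gb gb' h1 h2 h3 h4.
have [z az bz] := to_anchor gb h1 h2; have [z' az' bz'] := to_anchor gb' h3 h4.
apply: connect_trans bz _; apply: connect_trans (anchor_connect (nb4 a) az az') _.
by rewrite lrel_csym.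
Qed.

Lemma half_good u v (a : 'I_m * 'I_m) : frame u v -> u a + M < m -> M <= v a -> v a + M < m ->
  (forall t, cadj a t -> ~~ good t) ->
  2 * qcount <= #|[pred t | (win a t && ~~ good t) && (u a < u t)]|.
Proof.
move=> F h1 h2 h3 nog; have e1 : u a + q < m by lia.
have e2 : q <= v a by lia.
have e3 : v a + q < m by lia.
apply: leq_trans (half_disc F e1 e2 e3) _.
apply: subset_leq_card; apply/fintype.subsetP => t; rewrite !inE => /andP[pt ut]; rewrite ut andbT nog // andbT.
by move: pt; rewrite (frame_cadj F) => /close_dn; rewrite (frame_win F); lia.
Qed.

(** The same count with half discs centred at [a] itself: without a good cell close to [a] they
    would consist of bad cells only. *)
Lemma near_good (a : 'I_m * 'I_m) : exists2 g, good g & cadj a g.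
Proof.
have [/andP[nI nJ]|nn] := boolP (nearI a && nearJ a).
  exists a; last by rewrite /cadj /close /dn !subnn; nia.
  by apply: (@nbad0_good a); [apply: nb0; rewrite nI nJ|rewrite /win /dn !subnn].
apply: contrapT => ex.
have na t : cadj a t -> ~~ good t.
  by move=> ca; apply/negP => gt; apply: ex; exists t.
have sd u v : frame u v -> u a + M < m -> M <= v a -> v a + M < m -> 2 * qcount <= nbad a.
  move=> F h1 h2 h3; apply: leq_trans (half_good F h1 h2 h3 na) _.
  by apply: subset_leq_card; apply/fintype.subsetP => t; rewrite !inE => /andP[].
have F := frame0; have G := frame_swap F; have Fl := frame_flip F.
have Gl := frame_flip G; have [l1 l2] := (ltn_ord a.1, ltn_ord a.2).
have [nI|nI] := boolP (nearI a); have [nJ|nJ] := boolP (nearJ a).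
- by rewrite nI nJ in nn.
- have := @nb2 a; rewrite nI => /(_ isT); rewrite ltnNge => /negP; apply.
  have [h|h] := ltnP a.1 M.
    by apply: (sd _ _ F) => //; move: nJ; rewrite /nearJ; lia.
  by apply: (sd _ _ Fl) => //; move: nJ nI; rewrite /nearJ /nearI; lia.
- have := @nb2 a; rewrite nJ orbT => /(_ isT); rewrite ltnNge => /negP; apply.
  have [h|h] := ltnP a.2 M.
    by apply: (sd _ _ G) => //; move: nI; rewrite /nearI; lia.
  by apply: (sd _ _ Gl) => //; move: nI nJ; rewrite /nearJ /nearI; lia.
- move: nI nJ; rewrite /nearI /nearJ => nI nJ.
  have h : 2 * qcount <= _ := half_good F _ _ _ na.
  have h' : 2 * qcount <= _ := half_good Fl _ _ _ na.
  have {h}:= h; have {h'}:= h'.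
  set B := [pred t | _ ]; set A := [pred t | _ && (_ a.1 < _)] => hB hA.
  suff : #|A| + #|B| <= nbad a.
    by have := nb4 a; have := hA; have := hB; lia.
  rewrite -cardUI (_ : #|[predI A & B]| = 0) ?addn0; last first.
    by apply: eq_card0 => t; rewrite !inE /=; apply/negP; have := ltn_ord t.1; lia.
  by apply: subset_leq_card; apply/fintype.subsetP => t; rewrite !inE => /orP[] /andP[].
Qed.

End GoodCells.

(** * Lattice points of a quarter disc *)

Section DiscCount.
Variable R : realType.
Implicit Types a b x y : R.

(* The area below the unit circle between the abscissae 0 and [sin t]. *)
Definition seg (t : R) : R := (t + sin t * cos t) / 2.

(** The height of the circle decreases, so the area of a strip is at most its width times its left
    height. The difference has derivative cos t (cos a - cos t) in [b], which is nonnegative. *)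
Lemma seg_le a b : 0 <= a -> a <= b -> b <= pi / 2 ->
  seg b - seg a <= cos a * (sin b - sin a).
Proof.
move=> a0 ab bp.
pose f (t : R) := cos a * sin t - 2^-1 * (t + sin t * cos t).
have df (t : R) : is_derive t 1 f (cos a * cos t - cos t ^+ 2).
  rewrite /f; apply: is_derive_eq.
  have := cos2Dsin2 t; rewrite /GRing.scale /=; lra.
suff : f a <= f b by rewrite /f /seg; lra.
apply: (@ger0_derive1_ndecr R f a b) => //.
- move=> t tab; rewrite derive1E derive_val.
  move: tab; rewrite in_itv /= => /andP[at_ tb].
  have pp : (0 : R) < pi by exact: pi_gt0.
  have ct : 0 <= cos t by apply: cos_ge0_pihalf; apply/andP; split; lra.
  have : cos t < cos a by rewrite ltr_cos // in_itv /=; apply/andP; split; lra.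
  by nra.
- by apply: derivable_within_continuous => t _.
Qed.

Lemma sqrt_step x y : 0 <= x -> x <= y -> y <= 1 ->
  seg (asin y) - seg (asin x) <= Num.sqrt (1 - x ^+ 2) * (y - x).
Proof.
move=> x0 xy y1.
have hx : -1 <= x <= 1 by apply/andP; split; lra.
have hy : -1 <= y <= 1 by apply/andP; split; lra.
have pp : (0 : R) < pi by exact: pi_gt0.
have sy : sin (asin y) = y by apply: asinK; rewrite in_itv.
have sx : sin (asin x) = x by apply: asinK; rewrite in_itv.
have mono (u v : R) : -1 <= u <= 1 -> -1 <= v <= 1 -> u <= v -> asin u <= asin v.
  move=> hu hv uv; rewrite leNgt; apply/negP => lt.
  have : sin (asin v) < sin (asin u).
    by rewrite ltr_sin ?in_itv /= ?asin_geNpi2 ?asin_lepi2.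
  by rewrite !asinK ?in_itv //= => /lt_geF; rewrite uv.
have a0 : asin (0 : R) = 0.
  by rewrite -[in LHS]sin0 sinK // in_itv /=; apply/andP; split; lra.
have := @seg_le (asin x) (asin y) _ (mono _ _ hx hy xy) (asin_lepi2 hy).
rewrite sx sy cos_asin //; apply.
by rewrite -a0; apply: mono => //; apply/andP; split; lra.
Qed.

(** A left Riemann sum of a decreasing function exceeds the integral; the strips telescope to the
    area of the quarter disc. *)
Lemma sum_sqrt_ge (q : nat) : (0 < q)%N ->
  pi / 4 * q%:R ^+ 2 <= \sum_(0 <= k < q) Num.sqrt (q%:R ^+ 2 - k%:R ^+ 2) :> R.
Proof.
move=> q0; have q0' : (0 : R) < q%:R by rewrite ltr0n.
have pp : (0 : R) < pi by exact: pi_gt0.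
pose g (k : nat) : R := seg (asin (k%:R / q%:R)).
have step k : (k < q)%N -> (g k.+1 - g k) * q%:R ^+ 2 <= Num.sqrt (q%:R ^+ 2 - k%:R ^+ 2).
  move=> kq.
  have h : g k.+1 - g k <= Num.sqrt (1 - (k%:R / q%:R) ^+ 2) * (k.+1%:R / q%:R - k%:R / q%:R).
    apply: sqrt_step.
    - by rewrite divr_ge0 ?ler0n.
    - by rewrite ler_pM2r ?invr_gt0 // ler_nat.
    - by rewrite ler_pdivrMr // mul1r ler_nat.
  apply: le_trans (ler_wpM2r (sqr_ge0 _) h) _; rewrite le_eqVlt; apply/orP; left; apply/eqP.
  have -> : k.+1%:R / q%:R - k%:R / q%:R = q%:R^-1 :> R.
    by rewrite -natr1; field; rewrite gt_eqF.
  have -> : q%:R ^+ 2 - k%:R ^+ 2 = q%:R ^+ 2 * (1 - (k%:R / q%:R) ^+ 2) :> R.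
    by field; rewrite gt_eqF.
  rewrite sqrtrM ?sqr_ge0 // sqrtr_sqr ger0_norm; last by rewrite ltW.
  by field; rewrite gt_eqF.
have -> : pi / 4 * q%:R ^+ 2 = \sum_(0 <= k < q) (g k.+1 - g k) * q%:R ^+ 2 :> R.
  rewrite -mulr_suml telescope_sumr // /g mul0r divff ?gt_eqF //; congr (_ * _).
  have -> : asin (1 : R) = pi / 2.
    by rewrite -[X in asin X]sin_pihalf sinK // in_itv /=; apply/andP; split; lra.
  have -> : asin (0 : R) = 0.
    by rewrite -[in LHS]sin0 sinK // in_itv /=; apply/andP; split; lra.
  rewrite /seg sin_pihalf cos_pihalf sin0; lra.
by rewrite !big_nat; apply: ler_sum => k /andP[_ kq]; exact: step.
Qed.

Lemma card_square_le (q s : nat) (c : nat) : (s <= q)%N -> (s ^ 2 + c <= q ^ 2)%N ->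
  (s.-1 <= #|[pred j : 'I_q | (0 < j)%N && (c + j.+1 ^ 2 <= q ^ 2)%N]|)%N.
Proof.
case: s => // s sq h; rewrite -[X in (X <= _)%N]card_ord.
have lt1 (j : 'I_s) : (j.+1 < q)%N by apply: leq_trans sq; have := ltn_ord j; lia.
pose g (j : 'I_s) : 'I_q := Ordinal (lt1 j).
rewrite -(@fintype.card_image _ _ g); last by move=> i j [] /val_inj.
apply: subset_leq_card; apply/fintype.subsetP => t /fintype.imageP[j _ ->].
rewrite !inE /=; have := ltn_ord j; nia.
Qed.

(** Each column loses at most 2, by rounding and by the excluded axis. The columns use the heights
    at abscissae 2, 3, ... where the Riemann sum starts at 0, which loses two more heights of at
    most [q]. In total the loss is at most [4 * q]. *)
Lemma qcount_ge (q : nat) : (0 < q)%N -> pi / 4 * q%:R ^+ 2 - 4 * q%:R <= (qcount q)%:R :> R.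
Proof.
move=> q0; have q0' : (0 : R) < q%:R by rewrite ltr0n.
pose c (i : nat) : nat := #|[pred j : 'I_q | (0 < j)%N && (i.+1 ^ 2 + j.+1 ^ 2 <= q ^ 2)%N]|.
have Q : qcount q = (\sum_(i < q | (0 < i)%N) c i)%N.
  transitivity (\sum_(i < q | (0 < i)%N)
    \sum_(j < q | (0 < j)%N && (i.+1 ^ 2 + j.+1 ^ 2 <= q ^ 2)%N) 1)%N.
    by rewrite pair_big_dep /= sum1_card.
  by apply: eq_bigr => i _; rewrite sum1_card.
have cge i : (i.+1 <= q)%N -> Num.sqrt (q%:R ^+ 2 - i.+1%:R ^+ 2) - 2 <= (c i)%:R :> R.
  move=> iq; set t : R := Num.sqrt _.
  have t0 : 0 <= t by exact: sqrtr_ge0.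
  have tt : t ^+ 2 = q%:R ^+ 2 - i.+1%:R ^+ 2.
    by rewrite sqr_sqrtr // subr_ge0 ler_pXn2r ?nnegrE ?ler0n // ler_nat.
  have /andP[s1 s2] := truncn_itv t0; set s := Num.truncn t in s1 s2.
  have ss : (s ^ 2 + i.+1 ^ 2 <= q ^ 2)%N.
    rewrite -(ler_nat R) natrD !natrX -lerBrDr -tt ler_pXn2r ?nnegrE ?ler0n //.
  have sq : (s <= q)%N by nia.
  have := card_square_le sq ss; rewrite -/(c i) -(ler_nat R).
  have : s%:R - 1 <= s.-1%:R :> R.
    by case: (s) => [|k]; [rewrite sub0r lerN10 // | rewrite -natr1 addrK].
  by move: s2; rewrite -natr1; lra.
rewrite Q natr_sum -(big_mkord (fun i => (0 < i)%N) (fun i => (c i)%:R)) /=.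
have := sum_sqrt_ge q0.
case: q q0 q0' c Q cge => // q _ q0' c Q cge.
rewrite big_nat_recl // expr0n subr0 sqrtr_sqr ger0_norm ?ler0n // => h.
rewrite big_mkcond big_nat_recl //= add0r.
have h2 : \sum_(0 <= i < q) (Num.sqrt (q.+1%:R ^+ 2 - i.+1%:R ^+ 2) - 2) - q.+1%:R <= \sum_(0 <= i < q) (c i.+1)%:R :> R.
  pose S k : R := Num.sqrt (q.+1%:R ^+ 2 - k%:R ^+ 2).
  have tel : \sum_(0 <= i < q) (S i.+2 - S i.+1) = S q.+1 - S 1%N.
    exact: (telescope_sumr (fun k => S k.+1)).
  have S1 : S 1%N <= q.+1%:R.
    rewrite -[leRHS]ger0_norm ?ler0n // -sqrtr_sqr ler_wsqrtr // gerBl.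
    by rewrite exprn_ge0 // ler0n.
  have S0 : 0 <= S q.+1 by exact: sqrtr_ge0.
  apply: (@le_trans _ _ (\sum_(0 <= i < q) (S i.+2 - 2))).
    have -> : \sum_(0 <= i < q) (S i.+2 - 2) =
        \sum_(0 <= i < q) (S i.+2 - S i.+1) + \sum_(0 <= i < q) (S i.+1 - 2).
      by rewrite -big_split; apply: eq_bigr => i _ /=; rewrite addrA subrK.
    by rewrite tel [leRHS]addrC; apply: lerD => //; lra.
  by rewrite !big_nat; apply: ler_sum => i /andP[_ iq]; apply: cge.
move: h2; rewrite sumrB big_const_nat subn0 iter_addr addr0 -[X in _ - X - _]mulr_natr.
move: h; rewrite -!(natr1 q); set X := \sum_(0 <= i < q) _; lra.
Qed.

End DiscCount.

(** * Flows of bounded energy *)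

Section Flows.
Variables (R : realType) (V : seq (R * R)) (r : R).
Implicit Types (d : R * R -> R) (theta : R * R -> R * R -> R) (p : R * R -> R).

Lemma adj_sym u v : adj r u v = adj r v u.
Proof.
rewrite /adj eq_sym; congr (_ && (Num.sqrt _ <= _)).
by congr (_ + _); rewrite -sqrrN opprB.
Qed.

(** Cauchy-Schwarz against a constant: the sum of all squared differences is nonnegative. *)
Lemma sum_sqr_card (I : finType) (A : pred I) (f : I -> R) :
  (\sum_(x in A) f x) ^+ 2 <= #|A|%:R * \sum_(x in A) f x ^+ 2.
Proof.
have : 0 <= \sum_(x in A) \sum_(y in A) (f x - f y) ^+ 2.
  by apply: sumr_ge0 => x _; apply: sumr_ge0 => y _; exact: sqr_ge0.
have -> : \sum_(x in A) \sum_(y in A) (f x - f y) ^+ 2 =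
    2 * (#|A|%:R * (\sum_(x in A) f x ^+ 2)) - 2 * (\sum_(x in A) f x) ^+ 2.
  transitivity (\sum_(x in A) (#|A|%:R * f x ^+ 2 + (- 2 * f x * \sum_(y in A) f y)
      + \sum_(y in A) f y ^+ 2)).
    apply: eq_bigr => x _; rewrite mulr_sumr mulr_natl -sumr_const -!big_split /=.
    by apply: eq_bigr => y _; ring.
  rewrite !big_split /= -mulr_sumr -mulr_suml -mulr_sumr sumr_const -mulr_natl.
  ring.
lra.
Qed.

(* Flows with prescribed divergence; [unit_flow] is the case of [delta_x - delta_y]. *)
Definition is_flow d theta : Prop :=
  [/\ forall u v, theta u v = - theta v u,
      forall u v, ~~ [&& u \in V, v \in V & adj r u v] -> theta u v = 0 &
      forall u, u \in V -> \sum_(v <- V) theta u v = d u].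

Lemma is_flow_sum (I : finType) (w : I -> R) (d : I -> R * R -> R) (theta_ : I -> R * R -> R * R -> R) :
  (forall x, is_flow (d x) (theta_ x)) ->
  is_flow (fun u => \sum_x w x * d x u) (fun u v => \sum_x w x * theta_ x u v).
Proof.
move=> h; split=> [u v|u v nuv|u uV].
- by rewrite -sumrN; apply: eq_bigr => x _; have [-> _ _] := h x; rewrite mulrN.
- by apply: big1 => x _; have [_ -> //] := h x; rewrite mulr0.
- rewrite exchange_big /=; apply: eq_bigr => x _; have [_ _ <- //] := h x.
  by rewrite mulr_sumr.
Qed.

Lemma is_flow_ext d d' theta : (forall u, u \in V -> d u = d' u) -> is_flow d theta -> is_flow d' theta.
Proof. by move=> e [? ? h]; split=> // u uV; rewrite h // e. Qed.

Lemma is_flow0 : is_flow (fun=> 0) (fun _ _ => 0).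
Proof. by split=> // [u v|u uV]; rewrite ?oppr0 // big1. Qed.

Lemma is_flowD d d' theta theta' : is_flow d theta -> is_flow d' theta' ->
  is_flow (fun u => d u + d' u) (fun u v => theta u v + theta' u v).
Proof.
move=> [a1 s1 f1] [a2 s2 f2]; split=> [u v|u v nuv|u uV].
- by rewrite a1 a2 opprD.
- by rewrite s1 // s2 // addr0.
- by rewrite big_split f1 // f2.
Qed.

Lemma is_flowN d theta : is_flow d theta -> is_flow (fun u => - d u) (fun u v => - theta u v).
Proof.
move=> [a1 s1 f1]; split=> [u v|u v nuv|u uV].
- by rewrite a1.
- by rewrite s1 // oppr0.
- by rewrite sumrN f1.
Qed.

Lemma energy0 : energy V (fun _ _ => 0 : R) = 0.
Proof.
by rewrite /energy big1 ?mulr0 // => u _; rewrite big1 // => v _; rewrite expr0n.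
Qed.

Lemma energyN theta : energy V (fun u v => - theta u v) = energy V theta.
Proof.
rewrite /energy; congr (_ * _); apply: eq_bigr => u _; apply: eq_bigr => v _.
by rewrite sqrrN.
Qed.

Lemma energyD theta theta' : energy V (fun u v => theta u v + theta' u v) <=
  2 * (energy V theta + energy V theta').
Proof.
rewrite /energy -mulrDr mulrCA ler_pM2l ?invr_gt0 // -big_split mulr_sumr /=.
apply: ler_sum => u _; rewrite -big_split mulr_sumr /=; apply: ler_sum => v _.
by have := sqr_ge0 (theta u v - theta' u v); lra.
Qed.

(** On each edge at most [B] summands are nonzero, so Cauchy-Schwarz there costs a factor [B]
    instead of the number of flows. *)
Lemma energy_overlap (I : finType) (w : I -> R) (theta_ : I -> R * R -> R * R -> R) (B : nat) (E0 : R) :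
  0 <= E0 -> (forall x, energy V (theta_ x) <= E0) ->
  (forall u v, (#|[pred x | theta_ x u v != 0%R]| <= B)%N) ->
  energy V (fun u v => \sum_x w x * theta_ x u v) <= B%:R * E0 * \sum_x w x ^+ 2.
Proof.
move=> E00 hE hB.
apply: (@le_trans _ _ (B%:R * \sum_x w x ^+ 2 * energy V (theta_ x))); last first.
  rewrite -mulrA ler_wpM2l ?ler0n // mulr_sumr; apply: ler_sum => x _.
  by rewrite mulrC ler_wpM2r ?sqr_ge0.
have -> : B%:R * (\sum_x w x ^+ 2 * energy V (theta_ x)) =
   2^-1 * \sum_(u <- V) \sum_(v <- V) B%:R * \sum_x (w x * theta_ x u v) ^+ 2.
  rewrite mulr_sumr.
  transitivity (2^-1 * \sum_(u <- V) \sum_x \sum_(v <- V) B%:R * (w x * theta_ x u v) ^+ 2).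
    rewrite exchange_big /= mulr_sumr; apply: eq_bigr => x _.
    rewrite /energy !mulr_sumr; apply: eq_bigr => u _; rewrite !mulr_sumr.
    by apply: eq_bigr => v _; ring.
  congr (_ * _); apply: eq_bigr => u _; rewrite exchange_big /=.
  by apply: eq_bigr => v _; rewrite mulr_sumr.
rewrite /energy ler_pM2l ?invr_gt0 //; apply: ler_sum => u _; apply: ler_sum => v _.
pose A := [pred x | theta_ x u v != 0].
have e (f : I -> R) : (forall x, x \notin A -> f x = 0) -> \sum_x f x = \sum_(x in A) f x.
  move=> h; rewrite [RHS]big_mkcond; apply: eq_bigr => x _.
  by case: ifPn => // /h.
rewrite (e (fun x => w x * theta_ x u v)); last first.
  by move=> x; rewrite inE negbK => /eqP ->; rewrite mulr0.
rewrite (e (fun x => (w x * theta_ x u v) ^+ 2)); last first.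
  by move=> x; rewrite inE negbK => /eqP ->; rewrite mulr0 expr0n.
apply: le_trans (sum_sqr_card _ _) _; apply: ler_wpM2r; last by rewrite ler_nat; exact: hB.
by apply: sumr_ge0 => x _; exact: sqr_ge0.
Qed.

(** Transport of the mass [p] to [p'] along the product coupling. For uniform measures on [K] points
    each it spreads over [K ^ 2] edges. *)
Definition pair_flow p p' : R * R -> R * R -> R := fun u v => p u * p' v - p v * p' u.

Definition mass p : R := \sum_(v <- V) p v.
Definition norm2 p : R := \sum_(v <- V) p v ^+ 2.

(** Adjacency is required only for [u != v], so the two supports may overlap: on the diagonal the
    flow vanishes by antisymmetry. *)
Lemma pair_flow_flow p p' : mass p = 1 -> mass p' = 1 ->
  (forall u v, p u != 0 -> p' v != 0 -> u != v -> [&& u \in V, v \in V & adj r u v]) ->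
  is_flow (fun u => p u - p' u) (pair_flow p p').
Proof.
move=> m1 m2 h; split=> [u v|u v nuv|u uV].
- by rewrite /pair_flow; ring.
- rewrite /pair_flow; have [->|uv] := eqVneq u v; first by ring.
  suff [-> ->] : p u * p' v = 0 /\ p v * p' u = 0 by rewrite subrr.
  split; apply/eqP; apply: contraT; rewrite mulf_eq0 negb_or => /andP[pu pv].
    by rewrite h in nuv.
  have := h _ _ pu pv; rewrite eq_sym => /(_ uv) /and3P[vV uV a].
  by rewrite vV uV adj_sym a in nuv.
- rewrite /pair_flow sumrB -mulr_sumr -[\sum_(i <- V) p' i]/(mass p') m2 mulr1.
  by rewrite -mulr_suml -[\sum_(i <- V) p i]/(mass p) m1 mul1r.
Qed.

Lemma pair_flow_energy p p' : energy V (pair_flow p p') <= 2 * norm2 p * norm2 p'.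
Proof.
have e : \sum_(u <- V) \sum_(v <- V) p u ^+ 2 * p' v ^+ 2 = norm2 p * norm2 p'.
  by rewrite /norm2 mulr_suml; apply: eq_bigr => u _; rewrite mulr_sumr.
have e' : \sum_(u <- V) \sum_(v <- V) p v ^+ 2 * p' u ^+ 2 = norm2 p * norm2 p'.
  by rewrite exchange_big -e.
apply: (@le_trans _ _ (2^-1 * \sum_(u <- V) \sum_(v <- V)
    (2 * (p u ^+ 2 * p' v ^+ 2) + 2 * (p v ^+ 2 * p' u ^+ 2)))).
  rewrite ler_pM2l ?invr_gt0 //; apply: ler_sum => u _; apply: ler_sum => v _.
  rewrite /pair_flow -!exprMn; have := sqr_ge0 (p u * p' v + p v * p' u); lra.
rewrite le_eqVlt; apply/orP; left; apply/eqP.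
transitivity (2^-1 * \sum_(u <- V) (2 * \sum_(v <- V) p u ^+ 2 * p' v ^+ 2
    + 2 * \sum_(v <- V) p v ^+ 2 * p' u ^+ 2)).
  by congr (_ * _); apply: eq_bigr => u _; rewrite big_split -!mulr_sumr.
rewrite big_split /= -!mulr_sumr e e' -mulrA; set X := norm2 p * norm2 p'; lra.
Qed.

End Flows.

(** * Flows between good cells and their superposition *)

Section CellFlows.
Variables (R : realType) (V : seq (R * R)) (r : R) (q M m K : nat).
Variables (cell : 'I_m * 'I_m -> pred (R * R)) (good : pred ('I_m * 'I_m)).
Hypothesis K0 : (0 < K)%N.
Hypothesis goodK : forall t, good t -> (K <= count (cell t) V)%N.
Hypothesis cell_inj : forall s t u, cell s u -> cell t u -> s = t.
Hypothesis cell_adj : forall s t u v, cadj q s t -> cell s u -> cell t v -> u != v -> adj r u v.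

Definition mu t (u : R * R) : R := ((u \in V) && cell t u)%:R / (count (cell t) V)%:R.

Lemma mu_neq0 t u : mu t u != 0 -> (u \in V) && cell t u.
Proof. by rewrite /mu; case: (_ && _) => //; rewrite mul0r eqxx. Qed.

Lemma sum_cell t : \sum_(v <- V) ((v \in V) && cell t v)%:R = (count (cell t) V)%:R :> R.
Proof.
rewrite -sum1_count natr_sum [RHS]big_mkcond big_seq [RHS]big_seq; apply: eq_bigr => v ->.
by case: (cell t v).
Qed.

Lemma count_gt0 t : good t -> (0 : R) < (count (cell t) V)%:R.
Proof. by move=> /goodK h; rewrite ltr0n (leq_trans K0 h). Qed.

Lemma mass_mu t : good t -> mass V (mu t) = 1.
Proof. by move=> /count_gt0 c0; rewrite /mass -mulr_suml sum_cell divff // gt_eqF. Qed.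

Lemma norm2_mu t : good t -> norm2 V (mu t) <= K%:R^-1.
Proof.
move=> gt; have c0 := count_gt0 gt.
have -> : norm2 V (mu t) = (count (cell t) V)%:R^-1.
  transitivity (\sum_(v <- V) mu t v * (count (cell t) V)%:R^-1).
    by apply: eq_bigr => v _; rewrite /mu; case: (_ && _); rewrite ?mul1r ?mul0r expr2 ?mul0r.
  by rewrite -mulr_suml -[X in X * _]/(mass V (mu t)) mass_mu // mul1r.
by rewrite lef_pV2 ?posrE ?c0 ?ltr0n ?K0 // ler_nat goodK.
Qed.

(** Locality, for the overlap count: an edge at [u] is used only by flows whose window contains the
    cell of [u]. *)
Definition near_flow a (theta : R * R -> R * R -> R) : Prop :=
  forall u v, theta u v != 0 -> exists2 t, win M a t & cell t u.

Lemma near_flowD a theta theta' : near_flow a theta -> near_flow a theta' ->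
  near_flow a (fun u v => theta u v + theta' u v).
Proof.
move=> n1 n2 u v; have [->|/n1 //] := eqVneq (theta u v) 0.
by rewrite add0r => /n2.
Qed.

Lemma lrel_flow a s t : lrel q M good a s t ->
  [/\ is_flow V r (fun u => mu s u - mu t u) (pair_flow (mu s) (mu t)),
      energy V (pair_flow (mu s) (mu t)) <= 2 / K%:R ^+ 2 & near_flow a (pair_flow (mu s) (mu t))].
Proof.
move=> /and5P[ws wt gs gt st]; split.
- apply: pair_flow_flow; [exact: mass_mu|exact: mass_mu|].
  move=> u v /mu_neq0 /andP[uV cu] /mu_neq0 /andP[vV cv] uv.
  by rewrite uV vV (cell_adj st cu cv uv).
- apply: le_trans (pair_flow_energy _ _ _) _.
  have -> : 2 / K%:R ^+ 2 = 2 * K%:R^-1 * K%:R^-1 :> R by rewrite -mulrA -expr2 exprVn.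
  have n0 p : 0 <= norm2 V p by apply: sumr_ge0 => v _; exact: sqr_ge0.
  have := norm2_mu gs; have := norm2_mu gt; have := n0 (mu s); have := n0 (mu t).
  set A := norm2 _ _; set B := norm2 _ _ => h1 h2 h3 h4; rewrite -!mulrA ler_pM2l //.
  by apply: ler_pM.
- move=> u v; rewrite /pair_flow; have [|cs] := boolP (mu s u == 0).
    move=> /eqP ->; rewrite mul0r sub0r oppr_eq0 mulf_eq0 negb_or => /andP[_ /mu_neq0 /andP[_ ct]].
    by exists t.
  by move=> _; exists s => //; have /andP[] := mu_neq0 cs.
Qed.

(** Adding a step at most doubles the sum of the energies, whence the factor 4 per step. This is
    affordable because the paths have bounded length. *)
Lemma path_flow a p b : path (lrel q M good a) b p -> exists theta,
  [/\ is_flow V r (fun u => mu b u - mu (last b p) u) theta,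
      energy V theta <= 4 ^+ size p * (2 / K%:R ^+ 2) & near_flow a theta].
Proof.
have k0 : (0 : R) <= 2 / K%:R ^+ 2 by rewrite divr_ge0 // exprn_ge0.
elim: p b => [|c p IH] b /=.
  move=> _; exists (fun _ _ => 0); split.
  - by apply: is_flow_ext (is_flow0 _ _) => u _; rewrite subrr.
  - by rewrite energy0 expr0 mul1r.
  - by move=> u v; rewrite eqxx.
move=> /andP[/lrel_flow[f1 e1 n1] /IH[th [f2 e2 n2]]].
exists (fun u v => pair_flow (mu b) (mu c) u v + th u v); split.
- by apply: is_flow_ext (is_flowD f1 f2) => u _; ring.
- apply: le_trans (energyD _ _ _) _; rewrite exprS.
  have : 1 <= 4 ^+ size p :> R by apply: exprn_ege1; lra.
  move: e1 e2; set X := _ / _; set E1 := energy _ _; set E2 := energy _ _; set F := _ ^+ _.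
  by move: k0; rewrite -/X => k0 e1 e2 f1'; nra.
- exact: near_flowD.
Qed.

Definition edge_energy : R := 4 ^+ ((2 * M).+1 ^ 2) * (2 / K%:R ^+ 2).

Lemma edge_energy_ge0 : 0 <= edge_energy.
Proof. by rewrite mulr_ge0 ?exprn_ge0 // divr_ge0 // exprn_ge0. Qed.

(** A shortened path visits distinct cells of the window, so its length is at most the size of the
    window. *)
Lemma connect_flow (a b b' : 'I_m * 'I_m) : connect (lrel q M good a) b b' -> exists theta,
  [/\ is_flow V r (fun u => mu b u - mu b' u) theta,
      energy V theta <= edge_energy & near_flow a theta].
Proof.
move=> /connectP[p0 /shortenP[p pp up _] ->].
have [th [h1 h2 h3]] := path_flow pp; exists th; split=> //; apply: le_trans h2 _.
apply: ler_wpM2r; first by rewrite divr_ge0 // exprn_ge0.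
apply: ler_weXn2l; first by lra.
apply: leq_trans (card_win M a).
have /andP[_ /card_uniqP <-] := up; apply: subset_leq_card; apply/fintype.subsetP => t.
rewrite inE; elim: p b pp {up h1 h3 th} => //= c p IH b /andP[/and5P[_ wc _ _ _] pp].
by rewrite inE => /orP[/eqP ->//|]; exact: IH pp.
Qed.

Variable g : 'I_m * 'I_m -> 'I_m * 'I_m.
Hypothesis g_good : forall a, good (g a).
Hypothesis g_adj : forall a, cadj q a (g a).
Hypothesis conn : forall a b b' : 'I_m * 'I_m, good b -> good b' ->
  (dn a.1 b.1 <= q.+1)%N -> (dn a.2 b.2 <= q.+1)%N ->
  (dn a.1 b'.1 <= q.+1)%N -> (dn a.2 b'.2 <= q.+1)%N -> connect (lrel q M good a) b b'.

Definition grid_step (a a' : 'I_m * 'I_m) : bool := (dn a.1 a'.1 <= 1)%N && (dn a.2 a'.2 <= 1)%N.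

(** Every grid cell, good or bad, is represented by a good cell close to it, so flows on the full
    grid can be transported. *)
Definition nu a : R * R -> R := mu (g a).

Lemma edge_flow : exists th : ('I_m * 'I_m) * ('I_m * 'I_m) -> R * R -> R * R -> R,
  forall x, grid_step x.1 x.2 ->
  [/\ is_flow V r (fun u => nu x.1 u - nu x.2 u) (th x),
      energy V (th x) <= edge_energy & near_flow x.1 (th x)].
Proof.
suff /choice[th hth] : forall x : ('I_m * 'I_m) * ('I_m * 'I_m), exists theta, grid_step x.1 x.2 ->
  [/\ is_flow V r (fun u => nu x.1 u - nu x.2 u) theta,
      energy V theta <= edge_energy & near_flow x.1 theta] by exists th.
move=> [a a'] /=; have [/andP[h1 h2]|] := boolP (grid_step a a'); last first.
  by exists (fun _ _ => 0).
have /close_dn [d1 d2] := g_adj a; have /close_dn [d3 d4] := g_adj a'.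
have c : connect (lrel q M good a) (g a) (g a').
  apply: conn => //; move: h1 h2 d1 d2 d3 d4; rewrite /dn; lia.
by have [th h] := connect_flow c; exists th.
Qed.

(** * Flows of logarithmic energy on the grid of cells *)

Section Square.
Variables (th : ('I_m * 'I_m) * ('I_m * 'I_m) -> R * R -> R * R -> R).
Hypothesis thP : forall x, grid_step x.1 x.2 ->
  [/\ is_flow V r (fun u => nu x.1 u - nu x.2 u) (th x),
      energy V (th x) <= edge_energy & near_flow x.1 (th x)].

(** The mass [1 / l.+1] at position [i] of level [l] times the probability of the next draw; [b]
    tells whether the first coordinate grows. *)
Definition urn (l i : nat) (b : bool) : R :=
  (if b then i.+1%:R else (l - i).+1%:R) / (l.+1%:R * l.+2%:R).

Lemma urn_level (h f : nat -> R) (l : nat) :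
  \sum_(i < l.+1) \sum_b urn l i b * (h i - f (if b then i.+1 else i)) =
  (\sum_(i < l.+1) h i) / l.+1%:R - (\sum_(i < l.+2) f i) / l.+2%:R.
Proof.
have n1 : l.+1%:R != 0 :> R by rewrite pnatr_eq0.
have n2 : l.+2%:R != 0 :> R by rewrite pnatr_eq0.
have n2' : l.+2%:R = l.+1%:R + 1 :> R by rewrite natr1.
(* Position [i] of the next level receives weight [i] from position [i - 1] and [l.+1 - i] from
   position [i], in all [l.+1] whatever [i] is: uniformity persists. *)
have ef : l.+1%:R * (\sum_(i < l.+2) f i) =
    \sum_(i < l.+1) (i.+1%:R * f i.+1 + (l - i).+1%:R * f i).
  rewrite mulr_sumr.
  transitivity (\sum_(i < l.+2) i%:R * f i + \sum_(i < l.+2) (l.+1 - i)%:R * f i).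
    rewrite -big_split; apply: eq_bigr => i _ /=.
    by rewrite -mulrDl -natrD subnKC // -ltnS.
  rewrite big_ord_recl mul0r add0r [X in _ + X]big_ord_recr /= subnn mul0r addr0 -big_split.
  by apply: eq_bigr => i _ /=; rewrite subSn // -ltnS.
have -> : (\sum_(i < l.+2) f i) / l.+2%:R = (l.+1%:R * (\sum_(i < l.+2) f i)) / (l.+1%:R * l.+2%:R).
  by move: n1 n2; move: (l.+1%:R : R) (l.+2%:R : R) => A B n1 n2; field; rewrite n1 n2.
rewrite ef !mulr_suml -sumrB; apply: eq_bigr => i _.
have il : (i <= l)%N by rewrite -ltnS.
rewrite big_bool /urn /=; have -> : (l - i).+1%:R = l.+2%:R - i.+1%:R :> R.
  by rewrite -subSn // -natrB ?ltnS; [congr (_%:R); lia|lia].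
by move: n1 n2; move: (l.+1%:R : R) (l.+2%:R : R) => A B n1 n2; field; rewrite n1 n2.
Qed.

Lemma urn_le (l i : nat) b : (i <= l)%N -> 0 <= urn l i b <= l.+1%:R^-1.
Proof.
move=> il; rewrite /urn divr_ge0 ?mulr_ge0 //=; last by case: b.
rewrite ler_pdivrMr ?mulr_gt0 // mulKf ?pnatr_eq0 //.
by case: b; rewrite ler_nat; lia.
Qed.

Section Polya.
Variables (e : nat -> nat -> 'I_m * 'I_m) (k : nat).
Hypothesis e_right : forall i j, (i + j < k)%N -> grid_step (e i j) (e i.+1 j).
Hypothesis e_up : forall i j, (i + j < k)%N -> grid_step (e i j) (e i j.+1).
Hypothesis e_inj : forall i j i' j', (i + j < k)%N -> (i' + j' < k)%N ->
  e i j = e i' j' -> i = i' /\ j = j'.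

Definition antidiag (l : nat) (u : R * R) : R := (\sum_(i < l.+1) nu (e i (l - i)) u) / l.+1%:R.

Definition harmonic_sum (n : nat) : R := \sum_(l < n) l.+1%:R^-1.

(* Polya's urn: the mass that reaches level [l] is uniform on it, and the urn
   with [i + 1] and [l - i + 1] balls sends it on uniformly to level [l + 1]. *)
Lemma polya_flow : exists theta,
  is_flow V r (fun u => nu (e 0 0) u - antidiag k u) theta /\
  energy V theta <= (2 * (2 * M).+1 ^ 2)%:R * edge_energy * (2 * harmonic_sum k).
Proof.
(* An index consists of level, position and direction. The edges of the triangle are cut out of this
   product type by [ok], with zero flow elsewhere. *)
pose base (x : 'I_k * 'I_k * bool) := e x.1.2 (x.1.1 - x.1.2).
pose tip (x : 'I_k * 'I_k * bool) :=
  if x.2 then e x.1.2.+1 (x.1.1 - x.1.2) else e x.1.2 (x.1.1 - x.1.2).+1.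
pose ok (x : 'I_k * 'I_k * bool) := (x.1.2 <= x.1.1)%N.
pose PT x := if ok x then th (base x, tip x) else (fun _ _ => 0).
pose pd x u := if ok x then nu (base x) u - nu (tip x) u else 0.
pose w x := if ok x then urn x.1.1 x.1.2 x.2 else 0.
have okP x : ok x -> (x.1.2 + (x.1.1 - x.1.2) < k)%N.
  by rewrite /ok => o; rewrite subnKC.
have gs x : ok x -> grid_step (base x) (tip x).
  by move=> /okP o; rewrite /tip; case: ifP => _; [exact: e_right|exact: e_up].
have PTP x : is_flow V r (pd x) (PT x).
  rewrite /pd /PT; case: ifP => [/gs o|_]; last exact: is_flow0.
  by have [] := @thP (base x, tip x) o.
have reidx (F : nat -> nat -> bool -> R) :
    \sum_(x : 'I_k * 'I_k * bool) (if ok x then F x.1.1 x.1.2 x.2 else 0) =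
    \sum_(l < k) \sum_(i < l.+1) \sum_b F l i b.
  transitivity (\sum_(x : 'I_k * 'I_k) \sum_b (if (x.2 <= x.1)%N then F x.1 x.2 b else 0)).
    by rewrite pair_bigA; apply: eq_bigr => -[[l i] b].
  transitivity (\sum_(l < k) \sum_(i < k) \sum_b (if (i <= l)%N then F l i b else 0)).
    by rewrite [RHS]pair_bigA; apply: eq_bigr => -[l i].
  apply: eq_bigr => l _.
  rewrite (big_ord_widen k (fun i => \sum_b F l i b)) // [RHS]big_mkcond.
  apply: eq_bigr => i _ /=; rewrite ltnS; case: ifP => // _.
  by rewrite big1.
exists (fun u v => \sum_x w x * PT x u v); split.
  apply: is_flow_ext (is_flow_sum w PTP) => u _.
  pose F l i (b : bool) := urn l i b * (nu (e i (l - i)) u - nu (e (if b then i.+1 else i) (l.+1 - (if b then i.+1 else i))) u).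
  transitivity (\sum_(x : 'I_k * 'I_k * bool) (if ok x then F x.1.1 x.1.2 x.2 else 0)).
    apply: eq_bigr => -[[l i] b] _; rewrite /w /pd /F /base /tip /ok /=.
    case: ifP => il; last by rewrite mul0r.
    by case: b => //; rewrite subSn.
  rewrite reidx.
  transitivity (\sum_(0 <= l < k) (antidiag l u - antidiag l.+1 u)).
    rewrite big_mkord; apply: eq_bigr => l _.
    exact: (urn_level (fun i => nu (e i (l - i)) u) (fun i => nu (e i (l.+1 - i)) u)).
  transitivity (- \sum_(0 <= l < k) (antidiag l.+1 u - antidiag l u)).
    by rewrite -sumrN; apply: eq_bigr => l _; rewrite opprB.
  by rewrite telescope_sumr // opprB {1}/antidiag big_ord1 divr1.
apply: le_trans (@energy_overlap _ _ _ w PT (2 * (2 * M).+1 ^ 2) _ edge_energy_ge0 _ _) _.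
- move=> x; rewrite /PT; case: ifP => [/gs o|_]; last by rewrite energy0 edge_energy_ge0.
  by have [] := @thP (base x, tip x) o.
- move=> u v; have [[t0 ct0]|no] := pselect (exists t, cell t u); last first.
    rewrite eq_card0 // => x; rewrite !inE; apply/negP; rewrite /PT; case: ifP => [|_]; last by rewrite eqxx.
    move=> o; have [_ _ n] := @thP (base x, tip x) (gs _ o).
    by move=> nz; have [t _ ct] := n _ _ (introN idP nz); apply: no; exists t.
  (* Direction and base determine a grid edge, and the base of an edge whose flow uses [u] lies in
     the window of the cell [t0] of [u]. *)
  pose W := [pred t | win M t0 t].
  pose f (x : 'I_k * 'I_k * bool) := (x.2, base x).
  apply: (@leq_trans #|[predX (@predT bool) & W]|); last first.
    by have := cardX (@predT bool) W; rewrite card_bool => ->; rewrite leq_mul2l card_win.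
  rewrite -(@card_in_image _ _ f).
    apply: subset_leq_card; apply/fintype.subsetP => y /fintype.imageP[x]; rewrite !inE => nz ->.
    rewrite /f /=; move: nz; rewrite /PT; case: ifP => [okx | _]; last by rewrite eqxx.
    have [_ _ n] := @thP (base x, tip x) (gs _ okx); move=> nz; have [t wt ct] := n _ _ nz.
    by rewrite -(cell_inj ct ct0) in wt *; move: wt; rewrite /win /dn /=; lia.
  have nzok x : PT x u v != 0 -> ok x by rewrite /PT; case: ifP => // _; rewrite eqxx.
  move=> x y; rewrite !inE => /nzok ox /nzok oy [eb] ee.
  have [e1 e2] := e_inj (okP _ ox) (okP _ oy) ee.
  clear ee; case: x y ox oy e1 e2 eb => [[l i] b] [[l' i'] b']; rewrite /ok /= => ox oy e1 e2 ->.
  have -> : i = i' by apply: val_inj.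
  by congr (_, _, _); apply: val_inj => /=; lia.
rewrite ler_wpM2l ?mulr_ge0 ?edge_energy_ge0 //.
have -> : \sum_x w x ^+ 2 = \sum_(x : 'I_k * 'I_k * bool) (if ok x then urn x.1.1 x.1.2 x.2 ^+ 2 else 0).
  by apply: eq_bigr => x _; rewrite /w; case: ifP => // _; rewrite expr0n.
rewrite (reidx (fun l i b => urn l i b ^+ 2)) /harmonic_sum mulr_sumr; apply: ler_sum => l _.
(* Level [l] has [2 * l.+1] edges of weight at most [1 / l.+1], which leaves a term of the harmonic
   series. *)
apply: (@le_trans _ _ (\sum_(i < l.+1) (2 * l.+1%:R^-1 ^+ 2))).
  apply: ler_sum => i _; have il : (i <= l)%N by rewrite -ltnS.
  rewrite big_bool mulr_natl mulr2n lerD //; rewrite ler_pXn2r ?nnegrE ?invr_ge0 //;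
  by have /andP[] := urn_le true il; have /andP[] := urn_le false il.
rewrite sumr_const card_ord -[leLHS]mulr_natl le_eqVlt; apply/orP; left; apply/eqP.
have : l.+1%:R != 0 :> R by rewrite pnatr_eq0.
by move: (l.+1%:R : R) => A A0; field.
Qed.

End Polya.

(** Two urns started at opposite corners reach the same uniform mass on the antidiagonal, and their
    difference joins the corners. *)
Lemma square_flow (e : nat -> nat -> 'I_m * 'I_m) (k : nat) :
  (forall i j, (i < k)%N -> (j <= k)%N -> grid_step (e i j) (e i.+1 j)) ->
  (forall i j, (i <= k)%N -> (j < k)%N -> grid_step (e i j) (e i j.+1)) ->
  (forall i j i' j', (i <= k)%N -> (j <= k)%N -> (i' <= k)%N -> (j' <= k)%N ->
     e i j = e i' j' -> i = i' /\ j = j') ->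
  exists theta, is_flow V r (fun u => nu (e 0 0) u - nu (e k k) u) theta /\
    energy V theta <= 8 * (2 * (2 * M).+1 ^ 2)%:R * edge_energy * harmonic_sum k.
Proof.
move=> h1 h2 h3.
have sym a b : grid_step a b -> grid_step b a by rewrite /grid_step /dn; lia.
have [||| t1 [f1 E1]] := @polya_flow e k.
- by move=> i j ij; apply: h1; lia.
- by move=> i j ij; apply: h2; lia.
- by move=> i j i' j' ij ij'; apply: h3; lia.
have [||| t2 [f2 E2]] := @polya_flow (fun i j => e (k - i)%N (k - j)%N) k.
- move=> i j ij /=; apply: sym.
  have -> : (k - i = (k - i.+1).+1)%N by lia.
  by apply: h1; lia.
- move=> i j ij /=; apply: sym.
  have -> : (k - j = (k - j.+1).+1)%N by lia.
  by apply: h2; lia.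
- move=> i j i' j' ij ij' /h3 [||||a b]; lia.
exists (fun u v => t1 u v + - t2 u v); split.
  apply: is_flow_ext (is_flowD f1 (is_flowN f2)) => u _.
  suff -> : antidiag (fun i j => e (k - i)%N (k - j)%N) k u = antidiag e k u.
    by rewrite !subn0; ring.
  rewrite /antidiag; congr (_ / _); rewrite (reindex_inj rev_ord_inj); apply: eq_bigr => i _ /=.
  by have := ltn_ord i; rewrite ltnS => ik; congr (nu (e _ _) u); lia.
apply: le_trans (energyD _ _ _) _; rewrite energyN.
by move: E1 E2; set X := energy _ _; set Y := energy _ _; set Z := edge_energy; lra.
Qed.

Lemma harmonic_sum_le (k n : nat) : (k <= n)%N -> harmonic_sum k <= harmonic_sum n.
Proof.
move=> kn; rewrite /harmonic_sum (big_ord_widen n (fun l => l.+1%:R^-1 : R) kn) big_mkcond.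
by apply: ler_sum => i _; case: ifP => // _; rewrite invr_ge0.
Qed.

Lemma harmonic_sum_ge0 (n : nat) : 0 <= harmonic_sum n.
Proof. by apply: sumr_ge0 => i _; rewrite invr_ge0. Qed.

Definition grid_energy : R := 8 * (2 * (2 * M).+1 ^ 2)%:R * edge_energy * harmonic_sum m.

Variable i0 : 'I_m.
Definition pt (i j : nat) : 'I_m * 'I_m := (insubd i0 i, insubd i0 j).

Lemma pt1 i j : (i < m)%N -> (pt i j).1 = i :> nat.
Proof. by move=> im; rewrite /pt /= val_insubd im. Qed.

Lemma pt2 i j : (j < m)%N -> (pt i j).2 = j :> nat.
Proof. by move=> jm; rewrite /pt /= val_insubd jm. Qed.

Lemma pt_val (a : 'I_m * 'I_m) : pt a.1 a.2 = a.
Proof. by case: a => a b; congr (_, _); apply: val_inj; rewrite val_insubd /= ltn_ord. Qed.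

(** The sequences [x] and [y] run along the sides of a square in any of its orientations, so this
    serves diagonals of both directions. *)
Lemma jump_flow (x y : nat -> nat) (k : nat) : (k <= m)%N ->
  (forall i, (i <= k)%N -> (x i < m)%N /\ (y i < m)%N) ->
  (forall i, (i < k)%N -> (dn (x i) (x i.+1) <= 1)%N /\ (dn (y i) (y i.+1) <= 1)%N) ->
  (forall i j, (i <= k)%N -> (j <= k)%N -> x i = x j -> i = j) ->
  (forall i j, (i <= k)%N -> (j <= k)%N -> y i = y j -> i = j) ->
  exists theta,
    is_flow V r (fun u => nu (pt (x 0) (y 0)) u - nu (pt (x k) (y k)) u) theta /\
    energy V theta <= grid_energy.
Proof.
move=> km lt st ix iy.
have [|||th' [f E]] := @square_flow (fun i j => pt (x i) (y j)) k.
- move=> i j ik jk; have [xi _] := lt i (ltnW ik); have [xi' _] := lt i.+1 ik.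
  have [_ yj] := lt j jk; rewrite /grid_step !pt1 ?pt2 //.
  by have [-> _] := st _ ik; rewrite /dn !subnn.
- move=> i j ik jk; have [_ yi] := lt j (ltnW jk); have [_ yi'] := lt j.+1 jk.
  have [xj _] := lt i ik; rewrite /grid_step !pt1 ?pt2 //.
  by have [_ ->] := st _ jk; rewrite /dn !subnn.
- move=> i j i' j' ik jk ik' jk' e.
  have [xi _] := lt i ik; have [xi' _] := lt i' ik'.
  have [_ yj] := lt j jk; have [_ yj'] := lt j' jk'.
  split; [apply: ix => //|apply: iy => //].
    by move: (congr1 (fun a => val a.1) e); rewrite /= !val_insubd xi xi'.
  by move: (congr1 (fun a => val a.2) e); rewrite /= !val_insubd yj yj'.
exists th'; split=> //; apply: le_trans E _; apply: ler_wpM2l; last exact: harmonic_sum_le.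
by rewrite mulr_ge0 ?edge_energy_ge0.
Qed.

(* Along the antidiagonal to the main diagonal, then along the latter. *)
Lemma even_origin_flow (i j : nat) : (i < m)%N -> (j < m)%N -> ~~ odd (i + j) -> exists theta,
  is_flow V r (fun u => nu (pt i j) u - nu (pt 0 0) u) theta /\ energy V theta <= 4 * grid_energy.
Proof.
(* The antidiagonal through [(i, j)] meets the main diagonal in the cell [(s, s)]; the parity makes
   this a cell. *)
move=> im jm ev; pose s := (i + j)./2.
have es : (s.*2 = i + j)%N by rewrite /s even_halfK.
have sm : (s < m)%N by lia.
have [||||| t1 [f1 E1]] := @jump_flow id id s; [lia|by move=> k; lia|by rewrite /dn; move=> k; lia|by []|by []|].
have [t2 [f2 E2]] : exists theta,
    is_flow V r (fun u => nu (pt i j) u - nu (pt s s) u) theta /\ energy V theta <= grid_energy.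
  have [ij|ij] := leqP j i.
    have [||||| t2 [f2 E2]] := @jump_flow (fun k => i - k)%N (fun k => j + k)%N (i - s)%N.
    - lia.
    - by move=> k; lia.
    - by rewrite /dn; move=> k; lia.
    - by move=> k k'; lia.
    - by move=> k k'; lia.
    exists t2; split=> //; move: f2; rewrite subn0 addn0.
    have -> : (i - (i - s) = s)%N by lia.
    by have -> : (j + (i - s) = s)%N by lia.
  have [||||| t2 [f2 E2]] := @jump_flow (fun k => i + k)%N (fun k => j - k)%N (j - s)%N.
  - lia.
  - by move=> k; lia.
  - by rewrite /dn; move=> k; lia.
  - by move=> k k'; lia.
  - by move=> k k'; lia.
  exists t2; split=> //; move: f2; rewrite subn0 addn0.
  have -> : (j - (j - s) = s)%N by lia.
  by have -> : (i + (j - s) = s)%N by lia.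
exists (fun u v => t2 u v + - t1 u v); split.
  by apply: is_flow_ext (is_flowD f2 (is_flowN f1)) => u _; ring.
apply: le_trans (energyD _ _ _) _; rewrite energyN.
by move: E1 E2; set X := energy _ _; set Y := energy _ _; lra.
Qed.

Lemma origin_flow (a : 'I_m * 'I_m) : exists theta,
  is_flow V r (fun u => nu a u - nu (pt 0 0) u) theta /\
  energy V theta <= 2 * edge_energy + 8 * grid_energy.
Proof.
have e0 := edge_energy_ge0.
have g0 : 0 <= grid_energy by rewrite mulr_ge0 ?harmonic_sum_ge0 // mulr_ge0.
have [od|ev] := boolP (odd (a.1 + a.2)); last first.
  have [th' [f E]] := even_origin_flow (ltn_ord a.1) (ltn_ord a.2) ev.
  by exists th'; rewrite pt_val in f; split=> //; lra.
(* One step that lowers the larger coordinate, positive because the sum is odd, makes the parity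
   even. *)
have [i [j [im jm ev st]]] : exists i j, [/\ (i < m)%N, (j < m)%N, ~~ odd (i + j) & grid_step a (pt i j)].
  have [l1 l2] := (ltn_ord a.1, ltn_ord a.2).
  have [h|h] := leqP a.1 a.2.
    exists a.1, a.2.-1; rewrite /grid_step pt1 ?pt2; [|lia|lia].
    by split; [| | |rewrite /dn]; lia.
  exists a.1.-1, a.2; rewrite /grid_step pt1 ?pt2; [|lia|lia].
  by split; [| | |rewrite /dn]; lia.
have [f1 E1 _] := @thP (a, pt i j) st; have [t2 [f2 E2]] := even_origin_flow im jm ev.
exists (fun u v => th (a, pt i j) u v + t2 u v); split.
  by apply: is_flow_ext (is_flowD f1 f2) => u _ /=; ring.
apply: le_trans (energyD _ _ _) _.
by move: E1 E2; set X := energy _ _; set Y := energy _ _; lra.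
Qed.

End Square.

(** A point mass has [norm2] equal to 1, so only one of the two factors [1 / K] remains. *)
Lemma vertex_flow (x : R * R) (a : 'I_m * 'I_m) : uniq V -> x \in V ->
  (forall t v, cadj q a t -> cell t v -> x != v -> adj r x v) ->
  exists theta, is_flow V r (fun u => (u == x)%:R - nu a u) theta /\
    energy V theta <= 2 / K%:R.
Proof.
move=> uV xV hx; pose p (u : R * R) : R := (u == x)%:R.
have s1 : \sum_(v <- V) p v = 1 by rewrite (bigD1_seq x) //= {1}/p eqxx big1 ?addr0 // /p => v /negbTE ->.
exists (pair_flow p (nu a)); split.
  apply: pair_flow_flow; [exact: s1|exact: mass_mu|].
  move=> u v; rewrite /p; have [->|] := eqVneq u x; last by rewrite eqxx.
  by move=> _ /mu_neq0 /andP[vV cv] xv; rewrite xV vV /= (hx _ _ (g_adj a) cv).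
apply: le_trans (pair_flow_energy _ _ _) _.
have -> : norm2 V p = 1.
  by rewrite -[RHS]s1; apply: eq_bigr => v _; rewrite /p; case: (v == x); rewrite ?expr0n ?expr1n.
by rewrite mulr1 ler_pM2l // norm2_mu.
Qed.

Lemma effres_le (x y : R * R) (a b : 'I_m * 'I_m) : uniq V -> x \in V -> y \in V ->
  (forall t v, cadj q a t -> cell t v -> x != v -> adj r x v) ->
  (forall t v, cadj q b t -> cell t v -> y != v -> adj r y v) ->
  (effres V r x y <= (16 / K%:R + 16 * edge_energy + 64 * grid_energy)%:E)%E.
Proof.
move=> uV xV yV hx hy; have [th thP] := edge_flow.
have [t1 [f1 E1]] := vertex_flow uV xV hx; have [t2 [f2 E2]] := vertex_flow uV yV hy.
(* Both ends are routed through the cell at the origin. The argument [a.1] only supplies an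
   inhabitant of the index type. *)
have [t3 [f3 E3]] := origin_flow thP a.1 a; have [t4 [f4 E4]] := origin_flow thP a.1 b.
pose t u v := (t1 u v + t3 u v) + - (t2 u v + t4 u v).
apply: (@le_trans _ _ (energy V t)%:E).
  apply: ereal_inf_lbound; exists t => //.
  have [h1 h2 h3] := is_flowD (is_flowD f1 f3) (is_flowN (is_flowD f2 f4)).
  split=> // u u_V; rewrite /t h3 //; ring.
rewrite lee_fin; apply: le_trans (energyD _ _ _) _; rewrite energyN.
have := energyD V t1 t3; have := energyD V t2 t4; move: E1 E2 E3 E4.
set e1 := energy _ t1; set e2 := energy _ t2; set e3 := energy _ t3; set e4 := energy _ t4.
set e5 := energy _ _; set e6 := energy _ _; lra.
Qed.

End CellFlows.

(** * Sparse cells of a Poisson process *)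

Section Sparse.
Variables (R : realType) (d : measure_display) (Omega : measurableType d).
Variables (P : probability Omega R) (n : nat) (X : Omega -> seq (R * R)).
Hypothesis PX : is_PPP P n X.
Variables (T : finType) (A : T -> set (R * R)) (lam : R) (K : nat).
Hypothesis Am : forall t, measurable (A t).
Hypothesis AL : forall t, A t `<=` Lambda n.
Hypothesis AD : forall s t, s != t -> A s `&` A t = set0.
Hypothesis Alam : forall t, leb2 (A t) = lam%:E.
Hypothesis lam0 : 0 <= lam.

Definition pois_lt (rate : R) (k : nat) : R := \sum_(j < k) ppmf rate j.

Lemma ppmf_ge0 (rate : R) j : 0 <= rate -> 0 <= ppmf rate j.
Proof. by move=> r0; rewrite mulr_ge0 ?expR_ge0 // divr_ge0 ?exprn_ge0. Qed.

Lemma pois_lt_ge0 (rate : R) k : 0 <= rate -> 0 <= pois_lt rate k.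
Proof. by move=> r0; apply: sumr_ge0 => j _; exact: ppmf_ge0. Qed.

Lemma expR_partial_sum (x : R) k : 0 <= x -> \sum_(j < k) x ^+ j / j`!%:R <= expR x.
Proof.
move=> x0; have := @nondecreasing_cvgn_le _ (series (exp_coeff x)) _ (is_cvg_series_exp_coeff x) k.
rewrite /series /= big_mkord; apply.
apply: nondecreasing_series => i _ _; exact: exp_coeff_ge0.
Qed.

(** Chernoff: each term with [j < k] is multiplied by expR (t (k - j)), which is at least 1, and the
    sum is completed to the exponential series. *)
Lemma pois_lt_chernoff (rate : R) k (t : R) : 0 <= rate -> 0 <= t ->
  pois_lt rate k <= expR (t * k%:R - rate * (1 - expR (- t))).
Proof.
move=> r0 t0.
apply: (@le_trans _ _ (expR (t * k%:R) * expR (- rate) * \sum_(j < k) (rate * expR (- t)) ^+ j / j`!%:R)).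
  rewrite /pois_lt mulr_sumr; apply: ler_sum => j _; rewrite /ppmf exprMn.
  have -> : rate ^+ j / j`!%:R * expR (- rate) = 1 * (rate ^+ j / j`!%:R * expR (- rate)) by rewrite mul1r.
  have -> : expR (t * k%:R) * expR (- rate) * (rate ^+ j * expR (- t) ^+ j / j`!%:R) =
    (expR (t * k%:R) * expR (- t) ^+ j) * (rate ^+ j / j`!%:R * expR (- rate)) by ring.
  apply: ler_wpM2r; first exact: ppmf_ge0.
  rewrite -expRM_natl -expRD; apply: le_trans (expR_ge1Dx _).
  have : (j%:R : R) <= k%:R by rewrite ler_nat ltnW.
  by move=> jk; have := ler_wpM2l t0 jk; lra.
have h : 0 <= rate * expR (- t) by rewrite mulr_ge0 ?expR_ge0.
apply: le_trans (ler_wpM2l _ (expR_partial_sum k h)) _; first by rewrite mulr_ge0 ?expR_ge0.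
by rewrite -!expRD ler_expR; lra.
Qed.

Lemma measurable_count_lt t : measurable [set w | (count_in (A t) (X w) < K)%N].
Proof.
have [_ mc _] := PX.
have -> : [set w | (count_in (A t) (X w) < K)%N] =
    \bigcup_(j in `I_K) [set w | count_in (A t) (X w) = j].
  apply/seteqP; split=> w /=; first by move=> h; exists (count_in (A t) (X w)).
  by case=> j /= jK ->.
by apply: fin_bigcup_measurable => [|j _]; [exact: finite_II|exact: mc].
Qed.

Definition all_sparse (k : nat) (f : 'I_k -> T) : set Omega :=
  \bigcap_(i in [set: 'I_k]) [set w | (count_in (A (f i)) (X w) < K)%N].

Lemma all_sparse_measurable k (f : 'I_k -> T) : measurable (all_sparse f).
Proof.
apply: fin_bigcap_measurable => [|i _]; [exact: finite_finset|exact: measurable_count_lt].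
Qed.

Lemma measure_bigU_le (I : finType) (Q : pred I) (F : I -> set Omega) (c : I -> R) :
  (forall i, Q i -> measurable (F i)) -> (forall i, Q i -> (P (F i) <= (c i)%:E)%E) ->
  (P (\big[setU/set0]_(i | Q i) F i) <= (\sum_(i | Q i) c i)%:E)%E.
Proof.
move=> mF hF; rewrite -sumEFin.
suff : measurable (\big[setU/set0]_(i | Q i) F i) /\
  (P (\big[setU/set0]_(i | Q i) F i) <= \sum_(i | Q i) (c i)%:E)%E by case.
apply: (big_rec2 (fun (U : set Omega) (x : \bar R) => measurable U /\ (P U <= x)%E)).
  by split; [exact: measurable0|rewrite measure0].
move=> i x U Qi [mU hU]; split; first by apply: measurableU => //; exact: mF.
apply: le_trans (measureU2 _ (mF _ Qi) mU) _.
by apply: leeD => //; exact: hF.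
Qed.

(** Independence is given for exact counts, so the event is split according to the vector of counts
    below [K]; the sum of products is then a power. *)
Lemma all_sparse_le k (f : 'I_k -> T) : injective f ->
  (P (all_sparse f) <= (pois_lt lam K ^+ k)%:E)%E.
Proof.
move=> finj; have [_ mc ind] := PX.
pose F (c : {ffun 'I_k -> 'I_K}) : set Omega :=
  \bigcap_(i in [set: 'I_k]) [set w | count_in (A (f i)) (X w) = c i].
have mF c : measurable (F c).
  by apply: fin_bigcap_measurable => [|i _]; [exact: finite_finset|exact: mc].
have PF c : (P (F c) <= (\prod_(i < k) ppmf lam (c i))%:E)%E.
  rewrite /F (ind k (fun i => A (f i)) (fun i => c i)) //.
    by rewrite lee_fin le_eqVlt; apply/orP; left; apply/eqP; apply: eq_bigr => i _; rewrite Alam.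
  by move=> i j ij; apply: AD; apply: contra ij => /eqP /finj ->.
have sub : all_sparse f `<=` \big[setU/set0]_(c : {ffun 'I_k -> 'I_K}) F c.
  move=> w h; rewrite -bigcup_seq /=.
  exists [ffun i => Ordinal (h i I)] => /=; first by rewrite mem_index_enum.
  by move=> i _ /=; rewrite ffunE.
apply: (@le_trans _ _ (P (\big[setU/set0]_(c : {ffun 'I_k -> 'I_K}) F c))).
  apply: le_measure => //; rewrite inE; first exact: all_sparse_measurable.
  by apply: bigsetU_measurable => c _; exact: mF.
apply: le_trans (measure_bigU_le (fun c _ => mF c) (fun c _ => PF c)) _.
rewrite lee_fin -(bigA_distr_bigA (fun (i : 'I_k) (j : 'I_K) => ppmf lam j)) /=.
by rewrite prodr_const card_ord.
Qed.

Variables (C : pred T) (W : T -> pred T) (wmax : nat).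
Hypothesis Wmax : forall a, (#|W a| <= wmax)%N.

(** Sets of [k] sparse cells are listed as injective tuples: this is a finite union, hence
    measurable, and each tuple has independent counts. *)
Definition crowded (k : nat) : set Omega :=
  \big[setU/set0]_(x : T * {ffun 'I_k -> T} |
    C x.1 && (injectiveb x.2 && [forall i, W x.1 (x.2 i)])) all_sparse x.2.

Lemma crowded_measurable k : measurable (crowded k).
Proof. by apply: bigsetU_measurable => x _; exact: all_sparse_measurable. Qed.

Lemma crowded_le k : (P (crowded k) <= ((#|C| * wmax ^ k)%:R * pois_lt lam K ^+ k)%:E)%E.
Proof.
apply: le_trans (measure_bigU_le (c := fun=> pois_lt lam K ^+ k) _ _) _.
- by move=> x _; exact: all_sparse_measurable.
- by move=> x /and3P[_ /injectiveP inj _]; exact: all_sparse_le.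
rewrite lee_fin sumr_const -[leLHS]mulr_natl ler_wpM2r ?exprn_ge0 ?pois_lt_ge0 // ler_nat.
rewrite -sum1_card -(pair_big_dep C
  (fun a (f : {ffun 'I_k -> T}) => injectiveb f && [forall i, W a (f i)]) (fun _ _ => 1%N)) /=.
rewrite -sum_nat_const; apply: leq_sum => a _; rewrite sum1_card.
apply: (@leq_trans #|ffun_on (W a) : pred {ffun 'I_k -> T}|).
  apply: subset_leq_card; apply/fintype.subsetP => f; rewrite !inE => /andP[_ /forallP h].
  by apply/ffun_onP => i; exact: h.
by rewrite card_ffun_on card_ord; have [->|k0] := posnP k; rewrite ?expn0 ?leq_exp2r.
Qed.

Lemma crowdedP k a w : C a ->
  (k <= #|[pred t | W a t && ~~ (K <= count_in (A t) (X w))%N]|)%N -> crowded k w.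
Proof.
move=> Ca; set B := [pred t | _] => kB.
pose f := [ffun i : 'I_k => enum_val (widen_ord kB i)].
have fB i : f i \in B by rewrite ffunE enum_valP.
rewrite /crowded -bigcup_seq_cond /=; exists (a, f) => /=.
  rewrite mem_index_enum Ca /=; apply/andP; split.
    by apply/injectiveP => i j; rewrite !ffunE => /enum_val_inj /(congr1 val) /= /val_inj.
  by apply/forallP => i; have := fB i; rewrite inE => /andP[].
by move=> i _ /=; have := fB i; rewrite inE -ltnNge => /andP[].
Qed.

End Sparse.

(** * Geometry of the tiling *)

Section CellSets.
Variables (R : realType) (n m : nat).
Hypothesis m0 : (0 < m)%N.

Definition side : R := Num.sqrt n%:R / m%:R.

Definition lo (i : nat) : R := - (Num.sqrt n%:R / 2) + i%:R * side.

Definition cell_set (t : 'I_m * 'I_m) : set (R * R) :=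
  `[lo t.1, lo t.1.+1[%classic `*` `[lo t.2, lo t.2.+1[%classic.

Lemma side_ge0 : 0 <= side.
Proof. by rewrite divr_ge0 // sqrtr_ge0. Qed.

Lemma lo_le i j : (i <= j)%N -> lo i <= lo j.
Proof. by move=> ij; rewrite lerD2l ler_wpM2r ?side_ge0 // ler_nat. Qed.

Lemma loS i : lo i.+1 = lo i + side.
Proof. by rewrite /lo -natr1; ring. Qed.

Lemma lo0 : lo 0 = - (Num.sqrt n%:R / 2).
Proof. by rewrite /lo mul0r addr0. Qed.

Lemma lom : lo m = Num.sqrt n%:R / 2.
Proof. by rewrite /lo /side; field; rewrite pnatr_eq0 -lt0n. Qed.

Lemma measurable_cell_set t : measurable (cell_set t).
Proof. by apply: measurableX; exact: measurable_itv. Qed.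

Lemma leb2_cell_set t : leb2 (cell_set t) = (side ^+ 2)%:E.
Proof.
have h i : (@lebesgue_measure R) `[lo i, lo i.+1[%classic = side%:E.
  rewrite lebesgue_measure_itv /= loS lte_fin.
  have := side_ge0; rewrite le_eqVlt => /predU1P[<-|s0]; first by rewrite addr0 ltxx.
  by rewrite ltrDl s0 EFinN -EFinD; congr (_%:E); ring.
rewrite /leb2 /cell_set product_measure1E //; transitivity (side%:E * side%:E)%E.
  by congr (_ * _)%E; exact: h.
by rewrite -EFinM expr2.
Qed.

Lemma cell_set_Lambda t : cell_set t `<=` Lambda n.
Proof.
have h (i : 'I_m) x : lo i <= x < lo i.+1 -> -(Num.sqrt n%:R / 2) <= x <= Num.sqrt n%:R / 2.
  move=> /andP[x1 x2]; have := lo_le (leq0n i); have := lo_le (ltn_ord i); rewrite lo0 lom.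
  by move=> h1 h2; apply/andP; split; lra.
by move=> p [/=]; rewrite !in_itv /= => /h h1 /h h2.
Qed.

Lemma lo_inj i j x : lo i <= x < lo i.+1 -> lo j <= x < lo j.+1 -> i = j.
Proof.
move=> /andP[i1 i2] /andP[j1 j2]; apply/eqP; rewrite eqn_leq; apply/andP; split.
  by rewrite leqNgt; apply/negP => /lo_le; lra.
by rewrite leqNgt; apply/negP => /lo_le; lra.
Qed.

Lemma cell_set_inj s t p : cell_set s p -> cell_set t p -> s = t.
Proof.
case: s t => [a b] [a' b'] [/=]; rewrite !in_itv /= => h1 h2 [/=]; rewrite !in_itv /= => h3 h4.
by congr (_, _); apply: val_inj; [exact: lo_inj h1 h3|exact: lo_inj h2 h4].
Qed.

(** Half-open cells are disjoint, as independence requires, but miss the upper and right sides of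
    the square. Every vertex has to be located, so closed cells are used for that. *)
Definition closed_cell (t : 'I_m * 'I_m) (p : R * R) : Prop :=
  lo t.1 <= p.1 <= lo t.1.+1 /\ lo t.2 <= p.2 <= lo t.2.+1.

Lemma cell_set_closed t p : cell_set t p -> closed_cell t p.
Proof.
case=> /=; rewrite !in_itv /= => /andP[h1 h2] /andP[h3 h4].
by split; apply/andP; split=> //; exact: ltW.
Qed.

Lemma closed_cell_cover p : Lambda n p -> exists t, closed_cell t p.
Proof.
have h x : -(Num.sqrt n%:R / 2) <= x <= Num.sqrt n%:R / 2 ->
    exists i : 'I_m, lo i <= x <= lo i.+1.
  rewrite -lo0 -lom => /andP[x1 x2].
  have ex : exists i, (i < m)%N && (x <= lo i.+1) by exists m.-1; rewrite prednK // x2 leqnn.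
  case: (ex_minnP ex) => i /andP[im xi] mi.
  exists (Ordinal im); rewrite /= xi andbT; case: i im xi mi => // i im xi mi.
  rewrite leNgt; apply/negP => /ltW xl; have := mi i; rewrite xl (ltnW im) ltnn.
  by move=> /(_ isT).
by move=> [/h [i hi] /h [j hj]]; exists (i, j).
Qed.

Lemma lo_dist i j x y : lo i <= x <= lo i.+1 -> lo j <= y <= lo j.+1 ->
  (x - y) ^+ 2 <= (dn i j).+1%:R ^+ 2 * side ^+ 2.
Proof.
wlog ij : i j x y / (i <= j)%N.
  move=> H h1 h2; have [/H|/ltnW /H] := leqP i j; first exact.
  by move=> /(_ y x h2 h1); rewrite /dn addnC -[(y - x)%R]opprB sqrrN.
move=> /andP[x1 x2] /andP[y1 y2].
have e : (dn i j).+1 = (j.+1 - i)%N by rewrite /dn; lia.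
have e2 : lo j.+1 - lo i = (dn i j).+1%:R * side.
  by rewrite e natrB ?leqW // /lo; ring.
have := lo_le ij; rewrite -exprMn -e2 => lij.
set D := lo j.+1 - lo i.
have d1 : 0 <= D - (x - y) by rewrite /D; have := @lo_le i.+1 j.+1 ij; lra.
have d2 : 0 <= D + (x - y) by rewrite /D; lra.
have := mulr_ge0 d1 d2; lra.
Qed.

Lemma closed_cell_adj q r s t u v : 0 <= r -> side * q%:R <= r -> cadj q s t ->
  closed_cell s u -> closed_cell t v -> u != v -> adj r u v.
Proof.
move=> r0 sq; rewrite /cadj /close => st [u1 u2] [v1 v2] uv.
rewrite /adj uv /= -[leRHS]ger0_norm // -sqrtr_sqr ler_wsqrtr //.
apply: (@le_trans _ _ ((side * q%:R) ^+ 2)); last first.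
  by rewrite ler_pXn2r ?nnegrE ?mulr_ge0 ?side_ge0.
have h1 := lo_dist u1 v1; have h2 := lo_dist u2 v2.
move: st; rewrite -(ler_nat R) natrD !natrX => st.
have := ler_wpM2r (sqr_ge0 side) st; rewrite [(side * q%:R) ^+ 2]exprMn; lra.
Qed.

End CellSets.

(** * Elementary estimates of logarithms and exponentials *)

Section Calculus.
Variable R : realType.

Lemma harmonic_sum_ln (k : nat) : (0 < k)%N -> harmonic_sum R k <= 1 + ln k%:R.
Proof.
case: k => // k _; elim: k => [|k IH]; first by rewrite /harmonic_sum big_ord1 ln1 addr0 invr1.
rewrite /harmonic_sum big_ord_recr /= -/(harmonic_sum R k.+1).
have k2 : (0 : R) < k.+2%:R by rewrite ltr0n.
have k1 : (0 : R) < k.+1%:R by rewrite ltr0n.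
set x : R := k.+2%:R^-1.
have x1 : x < 1 by rewrite invf_lt1 // ltr1n.
have e : k.+1%:R = k.+2%:R * (1 + - x) :> R.
  by rewrite mulrDr mulr1 mulrN divff ?gt_eqF // -[X in X - 1]natr1 addrK.
have p : 0 < 1 + - x by rewrite subr_gt0.
have := @le_ln1Dx R (- x); rewrite ltrN2 => /(_ x1).
rewrite e lnM ?posrE // in IH; lra.
Qed.

Lemma ln_nat_ge (L : R) : exists N : nat, forall n : nat, (N <= n)%N -> L <= ln n%:R.
Proof.
exists (Num.truncn (expR L)).+1 => n Nn; rewrite -[L]expRK ler_ln ?posrE ?expR_gt0 //.
  apply: le_trans (ltW (truncnS_gt _)) _; by rewrite ler_nat.
by rewrite ltr0n; apply: leq_trans Nn.
Qed.

Lemma expR_ln_small (a b e : R) : 0 < b -> 0 < e ->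
  exists L : R, forall x, L <= x -> expR (a - b * x) <= e.
Proof.
move=> b0 e0; exists ((a - ln e) / b) => x; rewrite ler_pdivrMr // => h.
by rewrite -[leRHS]lnK ?posrE // ler_expR; lra.
Qed.

Lemma ln_sq_le (n : nat) : (0 < n)%N -> 1 <= n%:R :> R -> ln n%:R ^+ 2 <= 2 * n%:R :> R.
Proof.
move=> n0 n1; have l0 : 0 <= ln n%:R :> R by exact: ln_ge0.
have := expR_ge1Dxn 1 l0; rewrite lnK ?posrE ?ltr0n // (_ : 2`! = 2)%N //; lra.
Qed.

End Calculus.

(** * The resistance bound and the exceptional event *)

Section Assembly.
Variable R : realType.

Lemma card_edge (M m : nat) : (0 < M)%N ->
  (#|[pred i : 'I_m | (i < M) || (m <= i + M)]| <= 2 * M)%N.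
Proof.
case: M => // M _; set A := [pred i : 'I_m | _].
pose f (i : 'I_m) : bool * 'I_M.+1 := (i < M.+1, inord (if i < M.+1 then i : nat else m.-1 - i))%N.
have -> : (2 * M.+1)%N = #|{: bool * 'I_M.+1}| by rewrite card_prod card_bool card_ord.
apply: (@fintype.leq_card_in _ _ f) => i j; rewrite !inE => hi hj [e1 /(congr1 val)].
have := ltn_ord i; have := ltn_ord j; move: e1 hi hj => /= + + + lj li.
case: ltnP => ci; case: ltnP => cj //= _ hi hj; rewrite !inordK; try lia.
  by move=> e; apply: val_inj => /=; lia.
by move=> e; apply: val_inj => /=; lia.
Qed.

Lemma card_near (M m : nat) : (0 < M)%N ->
  (#|[pred a : 'I_m * 'I_m | nearI M a || nearJ M a]| <= 4 * M * m)%N.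
Proof.
move=> M0; pose E := [pred i : 'I_m | (i < M) || (m <= i + M)]%N.
have hE : (#|E| <= 2 * M)%N by exact: card_edge.
apply: (@leq_trans (#|[predX E & @predT 'I_m]| + #|[predX @predT 'I_m & E]|)).
  rewrite -cardUI; apply: leq_trans (leq_addr _ _); apply: subset_leq_card.
  apply/fintype.subsetP => a; rewrite !inE /nearI /nearJ /= => /orP[] ->; first by [].
  by rewrite orbT.
have -> := cardX E (@predT 'I_m); have -> := cardX (@predT 'I_m) E; rewrite card_ord.
by apply: leq_trans (leq_add (leq_mul hE (leqnn m)) (leq_mul (leqnn m) hE)) _; lia.
Qed.

Lemma card_corner (M m : nat) : (0 < M)%N ->
  (#|[pred a : 'I_m * 'I_m | nearI M a && nearJ M a]| <= 4 * M ^ 2)%N.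
Proof.
move=> M0; pose E := [pred i : 'I_m | (i < M) || (m <= i + M)]%N.
have hE : (#|E| <= 2 * M)%N by exact: card_edge.
apply: (@leq_trans #|[predX E & E]|).
  by apply: subset_leq_card; apply/fintype.subsetP => a; rewrite !inE.
by have -> := cardX E E; apply: leq_trans (leq_mul hE hE) _; lia.
Qed.

Lemma effres_cells (n m q M K : nat) (V : seq (R * R)) (r : R) (x y : R * R) :
  (3 <= q)%N -> (2 * q + 4 * qcount q + 2 <= M)%N -> (2 * M < m)%N -> (0 < K)%N ->
  0 <= r -> side R n m * q%:R <= r ->
  uniq V -> (forall p, p \in V -> Lambda n p) ->
  let good := fun t : 'I_m * 'I_m => (K <= count_in (cell_set n t) V)%N in
  (forall a, nbad M good a < 4 * qcount q)%N ->
  (forall a, nearI M a || nearJ M a -> nbad M good a < 2 * qcount q)%N ->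
  (forall a, nearI M a && nearJ M a -> nbad M good a = 0%N) ->
  x \in V -> y \in V ->
  (effres V r x y <= (16 / K%:R + 16 * edge_energy R M K + 64 * grid_energy R M m K)%:E)%E.
Proof.
move=> q3 hM hm K0 r0 sq uV VL good nb4 nb2 nb0 xV yV.
have m0 : (0 < m)%N by lia.
have [g gP] : exists g : 'I_m * 'I_m -> 'I_m * 'I_m, forall a, good (g a) /\ cadj q a (g a).
  have /choice[g gP] : forall a : 'I_m * 'I_m, exists b, good b /\ cadj q a b.
    by move=> a; have [b gb ab] := near_good q3 hM hm nb4 nb2 nb0 a; exists b.
  by exists g.
pose cell (t : 'I_m * 'I_m) : pred (R * R) := fun p => `[< cell_set n t p >].
have [a xa] := closed_cell_cover m0 (VL _ xV); have [b yb] := closed_cell_cover m0 (VL _ yV).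
apply: (@effres_le R V r q M m K cell good K0 _ _ _ g _ _ _ x y a b) => //.
- by move=> s t u /asboolP h1 /asboolP h2; exact: cell_set_inj h1 h2.
- move=> s t u v st /asboolP /cell_set_closed h1 /asboolP /cell_set_closed h2.
  exact: closed_cell_adj r0 sq st h1 h2.
- by move=> c; have [] := gP c.
- by move=> c; have [] := gP c.
- by move=> c b1 b2; exact: (local_connect q3 hM hm nb4 nb2 nb0).
- move=> t v at_ /asboolP /cell_set_closed; exact: closed_cell_adj r0 sq at_ xa.
- move=> t v at_ /asboolP /cell_set_closed; exact: closed_cell_adj r0 sq at_ yb.
Qed.

Section Event.
Variables (d : measure_display) (Omega : measurableType d).
Variables (P : probability Omega R) (n : nat) (X : Omega -> seq (R * R)).
Hypothesis PX : is_PPP P n X.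
Variables (m q M K : nat).
Hypothesis m0 : (0 < m)%N.
Hypothesis M0 : (0 < M)%N.

Let cr (C : pred ('I_m * 'I_m)) k := crowded X (@cell_set R n m) K C (@win M m) k.

(** The thresholds match the number of windows of each kind, which is of order [m ^ 2], [m] and
    1. *)
Definition bad_event : set Omega :=
  cr predT (4 * qcount q) `|` (cr [pred a | nearI M a || nearJ M a] (2 * qcount q) `|`
  cr [pred a | nearI M a && nearJ M a] 1).

Lemma cr_measurable C k : measurable (cr C k).
Proof. by apply: (crowded_measurable PX) => t; exact: measurable_cell_set. Qed.

Lemma bad_event_measurable : measurable bad_event.
Proof. by apply: measurableU; [|apply: measurableU]; exact: cr_measurable. Qed.

Let beta := pois_lt (side R n m ^+ 2) K.
Let w := ((2 * M).+1 ^ 2)%N.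

Lemma cr_le C k (c : nat) : (#|C| <= c)%N ->
  (P (cr C k) <= ((c * w ^ k)%:R * beta ^+ k)%:E)%E.
Proof.
move=> hc.
have b0 : 0 <= beta by apply: pois_lt_ge0; exact: sqr_ge0.
apply: le_trans (crowded_le (wmax := w) (lam := side R n m ^+ 2) PX K _ _ _ _ _ C _ k) _.
- by move=> t; exact: measurable_cell_set.
- by move=> t; exact: cell_set_Lambda.
- move=> s t st; apply/seteqP; split=> // p [h1 h2].
  by move: st; rewrite (cell_set_inj h1 h2) eqxx.
- by move=> t; exact: leb2_cell_set.
- exact: sqr_ge0.
- exact: card_win.
rewrite lee_fin ler_wpM2r ?exprn_ge0 // ler_nat leq_mul2r hc orbT //.
Qed.

Lemma bad_event_le : (P bad_event <= ((m ^ 2 * w ^ (4 * qcount q))%:R * beta ^+ (4 * qcount q) +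
  ((4 * M * m * w ^ (2 * qcount q))%:R * beta ^+ (2 * qcount q) + (4 * M ^ 2 * w)%:R * beta))%:E)%E.
Proof.
have mc := cr_measurable.
apply: le_trans (measureU2 _ (mc _ _) (measurableU _ _ (mc _ _) (mc _ _))) _.
rewrite EFinD; apply: leeD.
  by apply: cr_le; rewrite (eq_card (B := {: 'I_m * 'I_m})) // card_prod card_ord -mulnn.
apply: le_trans (measureU2 _ (mc _ _) (mc _ _)) _.
rewrite EFinD; apply: leeD; first by apply: cr_le; exact: card_near.
by have := @cr_le [pred a | nearI M a && nearJ M a] 1 _ (card_corner m M0); rewrite expn1 expr1.
Qed.

Lemma not_bad_event omega : ~ bad_event omega ->
  let good := fun t : 'I_m * 'I_m => (K <= count_in (cell_set n t) (X omega))%N in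
  [/\ forall a, (nbad M good a < 4 * qcount q)%N,
      forall a, nearI M a || nearJ M a -> (nbad M good a < 2 * qcount q)%N &
      forall a, nearI M a && nearJ M a -> nbad M good a = 0%N].
Proof.
move=> nb good.
have h (C : pred ('I_m * 'I_m)) k a : C a -> ~ cr C k omega -> (nbad M good a < k)%N.
  by move=> Ca ncr; rewrite ltnNge; apply/negP => hk; apply: ncr; exact: crowdedP Ca hk.
split=> a.
- by apply: (h predT) => // c; apply: nb; left.
- by move=> na; apply: (h [pred a | nearI M a || nearJ M a]) => // c; apply: nb; right; left.
- move=> na; have : (nbad M good a < 1)%N.
    by apply: (h [pred a | nearI M a && nearJ M a]) => // c; apply: nb; right; right.
  by lia.
Qed.

End Event.
End Assembly.

(** * Choice of the scales *)

Section Numerics.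
Variable R : realType.

Lemma grid_size (n q M : nat) (r eta : R) : 0 < eta < 1 -> (0 < q)%N -> 2 * q%:R <= r ->
  (2 * M%:R + 2 / eta) * r <= Num.sqrt n%:R ->
  exists m : nat, [/\ (2 * M < m)%N, side R n m * q%:R <= r, m%:R <= Num.sqrt n%:R :> R &
    (1 - eta) * (r / q%:R) ^+ 2 <= side R n m ^+ 2].
Proof.
move=> /andP[e0 e1] q0 qr hr; set S := Num.sqrt n%:R.
have q1 : 1 <= q%:R :> R by rewrite ler1n.
have r0 : 0 < r by lra.
have ei : 2 <= 2 / eta by rewrite ler_pdivlMr //; lra.
have M0 : 0 <= M%:R :> R by [].
have Mr : 0 <= M%:R * r by rewrite mulr_ge0 // ltW.
have S1 : 2 / eta * r <= S by move: hr; rewrite -/S; lra.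
have S2 : 2 * M%:R * r <= S.
  have : 0 <= 2 / eta * r by rewrite mulr_ge0 ?divr_ge0 // ltW.
  by move: hr; rewrite -/S; lra.
have S3 : 2 <= S by have : 2 * r <= 2 / eta * r; [by rewrite ler_pM2r|lra].
have S0 : 0 <= S by lra.
(* Cells of side exactly [r / q] would number [x] per row. Rounding up shrinks them, by a relative
   amount of at most [eta / 2] because [2 / eta * r] is at most [S]. *)
pose x := q%:R * S / r.
have x0 : 0 <= x by rewrite divr_ge0 ?mulr_ge0 // ltW.
have xr : x * r = q%:R * S by rewrite /x divfK // gt_eqF.
have /andP[t1 t2] := truncn_itv x0.
exists (Num.truncn x).+1; set m := (Num.truncn x).+1.
have m1 : m%:R <= x + 1 by rewrite /m -natr1 lerD2r.
have mx : x < m%:R by [].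
have m0 : 0 < m%:R :> R by rewrite ltr0n.
have sm : side R n m * m%:R = S by rewrite /side divfK // gt_eqF.
split.
- rewrite -(ltr_nat R) natrM; apply: le_lt_trans mx; rewrite /x ler_pdivlMr //.
  by apply: le_trans S2 _; rewrite ler_peMl.
- rewrite -(ler_pM2r m0) mulrAC sm mulrC -xr mulrC ler_pM2l // ltW //.
- apply: le_trans m1 _; have : x * 2 <= S; last by lra.
  rewrite -(ler_pM2r r0) mulrAC xr; have := ler_wpM2r S0 qr; lra.
- have h : (1 - eta / 2) * (r / q%:R) <= side R n m.
    rewrite -(ler_pM2r m0) sm.
    have rq : 0 < r / q%:R by rewrite divr_gt0 // ltr0n.
    have e2 : 0 < (1 - eta / 2) * (r / q%:R) by rewrite mulr_gt0 //; lra.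
    apply: le_trans (ler_wpM2l (ltW e2) m1) _.
    have rx : r / q%:R * x = S by rewrite /x; field; rewrite (gt_eqF r0) gt_eqF // ltr0n.
    have -> : (1 - eta / 2) * (r / q%:R) * (x + 1) =
      (1 - eta / 2) * (r / q%:R * x) + (1 - eta / 2) * (r / q%:R) by ring.
    rewrite rx.
    have h1 : r / q%:R <= r by rewrite ler_pdivrMr ?ltr0n // ler_peMr // ltW.
    have h2 : r <= eta / 2 * S.
      have := ler_wpM2l (_ : 0 <= eta / 2) S1; rewrite mulrA.
      have -> : eta / 2 * (2 / eta) = 1 by field; rewrite gt_eqF.
      by rewrite mul1r; apply; lra.
    have h3 : eta / 2 * (r / q%:R) >= 0 by rewrite mulr_ge0 ?ltW //; lra.
    lra.
  have h0 : 0 <= (1 - eta / 2) * (r / q%:R).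
    by rewrite mulr_ge0 ?divr_ge0 ?ltW //; lra.
  have -> : (1 - eta) * (r / q%:R) ^+ 2 = ((1 - eta / 2) * (r / q%:R)) ^+ 2 - (eta / 2 * (r / q%:R)) ^+ 2.
    by move: (r / q%:R) => z; field.
  apply: (@le_trans _ _ (((1 - eta / 2) * (r / q%:R)) ^+ 2)).
    by rewrite gerBl sqr_ge0.
  by rewrite ler_pXn2r ?nnegrE ?side_ge0.
Qed.

Lemma pi_ge2 : 2 <= pi :> R.
Proof. by have := @pihalf_ge1 R; lra. Qed.

(** With [q * eta] at least 8 and pi at least 2, the loss [4 * q] is at most the fraction [eta] of
    the main term. *)
Lemma qcount_ge_frac (q : nat) (eta : R) : 0 < eta -> 8 / eta <= q%:R ->
  pi / 4 * (1 - eta) * q%:R ^+ 2 <= (qcount q)%:R.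
Proof.
move=> e0; rewrite ler_pdivrMr // => hq.
have q0 : (0 < q)%N by rewrite lt0n; apply/eqP => q0; move: hq; rewrite q0 mul0r; lra.
apply: le_trans (qcount_ge R q0); have q0' : 0 <= q%:R :> R by [].
have h1 := ler_wpM2r q0' hq.
have h2 : 0 <= q%:R * eta * q%:R by rewrite !mulr_ge0 // ltW.
have := ler_wpM2r h2 pi_ge2; lra.
Qed.

(** Chernoff at [t = - ln eta], where 1 - expR (- t) equals [1 - eta]. The threshold [K] costs
    another [eta * lam * L], hence the factor [1 - 2 * eta]. *)
Lemma pois_lt_exp (rate lam eta L : R) (K : nat) : 0 < eta < 1 -> 0 <= lam -> 0 <= L ->
  lam * L <= rate -> - ln eta * K%:R <= eta * lam * L - ln eta ->
  pois_lt rate K <= expR (- ln eta - lam * (1 - 2 * eta) * L).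
Proof.
move=> /andP[e0 e1] l0 L0 hr hK.
have rate0 : 0 <= rate by apply: le_trans hr; exact: mulr_ge0.
have t0 : 0 <= - ln eta by rewrite oppr_ge0; apply: ln_le0; exact: ltW.
apply: le_trans (pois_lt_chernoff K rate0 t0) _; rewrite ler_expR opprK lnK ?posrE //.
have e1' : 0 <= 1 - eta by lra.
have := ler_wpM2r e1' hr; lra.
Qed.

(* The three terms come from the windows away from the boundary, near a side,
   and near a corner. *)
Lemma union_bound_le (m M w Q : nat) (beta rho : R) :
  0 <= beta -> beta <= rho -> m%:R * beta ^+ (2 * Q) <= rho -> rho <= 1 ->
  (m ^ 2 * w ^ (4 * Q))%:R * beta ^+ (4 * Q) +
    ((4 * M * m * w ^ (2 * Q))%:R * beta ^+ (2 * Q) + (4 * M ^ 2 * w)%:R * beta) <=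
  (w ^ (4 * Q) + 4 * M * w ^ (2 * Q) + 4 * M ^ 2 * w)%:R * rho.
Proof.
move=> b0 br mr r1; set y := m%:R * beta ^+ (2 * Q).
have y0 : 0 <= y by rewrite mulr_ge0 // exprn_ge0.
have -> : (m ^ 2 * w ^ (4 * Q))%:R * beta ^+ (4 * Q) = (w ^ (4 * Q))%:R * y ^+ 2.
  rewrite natrM; move: (w ^ (4 * Q))%:R => W4.
  rewrite (natrX R m 2) /y exprMn -exprM (_ : 2 * Q * 2 = 4 * Q)%N; last by lia.
  by rewrite mulrCA mulrA.
have -> : (4 * M * m * w ^ (2 * Q))%:R * beta ^+ (2 * Q) = (4 * M * w ^ (2 * Q))%:R * y.
  by rewrite /y !natrM; ring.
rewrite !natrD !mulrDl -addrA; apply: lerD; last first.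
  by apply: lerD; apply: ler_wpM2l.
apply: ler_wpM2l => //; apply: (le_trans _ mr); rewrite expr2 -/y ler_piMr //.
exact: le_trans mr r1.
Qed.

(** Edge energies are of order 1 / L^2. A single one is at most of order 1 / L since [1 <= L], and
    the harmonic sum raises the grid term only to order 1 / L. *)
Lemma total_energy_le (M m K : nat) (kap L : R) : 0 < kap -> 1 <= L ->
  kap * L <= K%:R -> harmonic_sum R m <= 2 * L -> (0 < K)%N ->
  16 / K%:R + 16 * edge_energy R M K + 64 * grid_energy R M m K <=
  (16 / kap + 16 * (edge_energy R M 1) / kap ^+ 2 +
    1024 * (2 * (2 * M).+1 ^ 2)%:R * (edge_energy R M 1) / kap ^+ 2) / L.
Proof.
move=> k0 L1 kK hH K0; have L0 : 0 < L by lra.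
have kL : 0 < kap * L by exact: mulr_gt0.
set c1 := edge_energy R M 1; have c10 : 0 <= c1 by exact: edge_energy_ge0.
have Kr : 0 < K%:R :> R by rewrite ltr0n.
have i1 : K%:R^-1 <= (kap * L)^-1 by rewrite lef_pV2.
have i0 : 0 <= K%:R^-1 :> R by rewrite invr_ge0.
have i2 : K%:R^-1 ^+ 2 <= (kap * L)^-1 ^+ 2 by rewrite ler_pXn2r ?nnegrE ?invr_ge0 // ltW.
have ee : edge_energy R M K = c1 * K%:R^-1 ^+ 2.
  by rewrite /c1 /edge_energy expr1n divr1 exprVn mulrA.
set W : R := (2 * (2 * M).+1 ^ 2)%:R; have W0 : 0 <= W by [].
have ge : grid_energy R M m K = 8 * W * c1 * (K%:R^-1 ^+ 2 * harmonic_sum R m).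
  by rewrite /grid_energy ee -/W; ring.
have eL : edge_energy R M K <= c1 / kap ^+ 2 / L.
  rewrite ee -mulrA; apply: ler_wpM2l => //; apply: le_trans i2 _.
  rewrite invfM exprMn -exprVn; apply: ler_wpM2l; first by rewrite exprn_ge0 // invr_ge0 ltW.
  by rewrite expr2; apply: ler_piMr; [rewrite invr_ge0 ltW|rewrite invf_le1].
have gL : grid_energy R M m K <= 16 * W * c1 / kap ^+ 2 / L.
  rewrite ge; apply: (@le_trans _ _ (8 * W * c1 * ((kap * L)^-1 ^+ 2 * (2 * L)))).
    apply: ler_wpM2l; first by rewrite !mulr_ge0.
    by apply: ler_pM => //; exact: harmonic_sum_ge0.
  rewrite le_eqVlt; apply/orP; left; apply/eqP; field.
  by rewrite (gt_eqF k0) (gt_eqF L0).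
have k1 : 16 / K%:R <= 16 / kap / L by rewrite -mulrA -invfM ler_pM2l.
apply: (@le_trans _ _ (16 / kap / L + 16 * (c1 / kap ^+ 2 / L) + 64 * (16 * W * c1 / kap ^+ 2 / L))).
  lra.
rewrite le_eqVlt; apply/orP; left; apply/eqP; ring.
Qed.

End Numerics.

Lemma choose_resolution (R : realType) (eta : R) : 0 < eta ->
  exists q : nat, (3 <= q)%N /\ pi / 4 * (1 - eta) * q%:R ^+ 2 <= (qcount q)%:R.
Proof.
move=> e0; exists (Num.truncn (8 / eta)).+3; split=> //; apply: qcount_ge_frac => //.
by apply: ltW; apply: lt_le_trans (truncnS_gt _) _; rewrite ler_nat ltnS ltnW.
Qed.

Lemma rgg_radius_sqr (R : realType) (eps : R) (n : nat) : 0 < eps -> 0 <= ln n%:R :> R ->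
  rgg_radius eps n ^+ 2 = (1 + eps) * ln n%:R / pi.
Proof.
move=> e0 l0; rewrite /rgg_radius sqr_sqrtr //.
by rewrite divr_ge0 ?mulr_ge0 ?pi_ge0 //; lra.
Qed.

(** These are the size conditions of [grid_size]. In the second, [r ^ 2] is of order log n, and log
    n is small against n by [ln_sq_le]. *)
Lemma large_n (R : realType) (eps eta : R) (q M n : nat) : 0 < eps -> 0 < eta ->
  1 <= ln n%:R :> R -> 4 * q%:R ^+ 2 * pi <= ln n%:R :> R ->
  2 * (2 * M%:R + 2 / eta) ^+ 2 * (1 + eps) <= ln n%:R :> R ->
  2 * q%:R <= rgg_radius eps n /\
  (2 * M%:R + 2 / eta) * rgg_radius eps n <= Num.sqrt n%:R.
Proof.
move=> e0 et0; set L := ln n%:R; set c := 2 * M%:R + 2 / eta => L1 L2 L3.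
have r0 : 0 <= rgg_radius eps n by exact: sqrtr_ge0.
have r2 := rgg_radius_sqr e0 (le_trans ler01 L1); rewrite -/L in r2.
have pi2 := pi_ge2 R.
have pi0 : 0 < pi :> R by lra.
have ei : 0 < 2 / eta by rewrite divr_gt0.
have c0 : 0 <= c by apply: addr_ge0; [rewrite mulr_ge0|exact: ltW].
split.
  rewrite -(ler_pXn2r (n := 2)) ?nnegrE ?mulr_ge0 // r2 ler_pdivlMr // exprMn.
  have : 0 <= eps * L by rewrite mulr_ge0; lra.
  by lra.
have n0 : (0 < n)%N.
  by rewrite lt0n; apply/eqP => n0; move: L1; rewrite /L n0 ln0 //; lra.
rewrite -[leLHS]ger0_norm ?mulr_ge0 // -sqrtr_sqr ler_wsqrtr // exprMn r2.
have := @ln_sq_le R n n0 (_ : 1 <= n%:R); rewrite ler1n => /(_ n0); rewrite -/L => nL.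
have h : c ^+ 2 * ((1 + eps) * L / pi) <= c ^+ 2 * ((1 + eps) * L).
  apply: ler_wpM2l; first exact: sqr_ge0.
  rewrite ler_pdivrMr // ler_peMr ?mulr_ge0 //; lra.
apply: le_trans h _.
have := ler_wpM2r (_ : 0 <= L) L3; rewrite -expr2 => h2.
have := h2 _; lra.
Qed.

Unset Implicit Arguments.

Theorem mainTheorem15 (R : realType) (eps : R) (heps : 0 < eps) :
  exists C : R, 0 < C /\
  forall (d : nat -> measure_display) (Omega : forall n, measurableType (d n))
         (P : forall n, probability (Omega n) R)
         (X : forall n, Omega n -> seq (R * R)),
    (forall n, is_PPP (P n) n (X n)) ->
    forall delta : R, 0 < delta ->
    exists N : nat, forall n : nat, (N <= n)%N ->
      exists E : set (Omega n),
        [/\ measurable E, ((1 - delta)%:E <= P n E)%E &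
            forall w, E w -> forall x y : R * R,
              x \in X n w -> y \in X n w -> x != y ->
              (effres (X n w) (rgg_radius eps n) x y <= (C / ln n%:R)%:E)%E].
Proof.
have eps1 : 0 < 1 + eps by lra.
(* Counting lattice points, rounding the side and the Chernoff bound lose [1 - eta], [1 - eta] and
   [1 - 2 * eta]. Their product is at least [1 - 4 * eta], and (1 - 4 eta) (1 + eps) = 1 + eps /
   2. *)
pose eta := eps / (8 * (1 + eps)).
have eta0 : 0 < eta by rewrite divr_gt0 ?mulr_gt0.
have etaE : eta * (1 + eps) = eps / 8 by rewrite /eta; field; rewrite gt_eqF.
have eta8 : eta < 8^-1 by rewrite -(ltr_pM2r eps1) etaE; lra.
have eta1 : 0 < eta < 1 by apply/andP; split=> //; lra.
have [q [q3 hq]] := choose_resolution eta0.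
have q0 : (0 < q)%N by lia.
have qR : 0 < q%:R :> R by rewrite ltr0n.
pose Q := qcount q.
have [M [M0 hM]] : exists M, (0 < M)%N /\ (2 * q + 4 * qcount q + 2 <= M)%N.
  by exists (2 * q + 4 * qcount q + 2)%N; rewrite addn2.
have pi2 := pi_ge2 R.
have pi0 : 0 < pi :> R by lra.
(* Up to a constant factor, a cell has area at least [lam * L] and is bad with probability at most
   expR (- c L), where [L] is log n and [c] is defined below. *)
pose lam := (1 - eta) * (1 + eps) / (pi * q%:R ^+ 2).
have lam0 : 0 < lam by rewrite divr_gt0 ?mulr_gt0 ?exprn_gt0 //; lra.
pose c := lam * (1 - 2 * eta).
have c0 : 0 < c by rewrite mulr_gt0 //; lra.
pose tau := - ln eta.
have tau0 : 0 < tau by rewrite oppr_gt0; apply: ln_lt0.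
(* A threshold of about [kap * L] points costs expR (tau kap L) in the Chernoff bound;
   [tau * kap = eta * lam] limits this to the fraction [eta] of the exponent. *)
pose kap := eta * lam / tau.
have kap0 : 0 < kap by rewrite divr_gt0 // mulr_gt0.
pose C := 16 / kap + 16 * (edge_energy R M 1) / kap ^+ 2 +
    1024 * (2 * (2 * M).+1 ^ 2)%:R * (edge_energy R M 1) / kap ^+ 2.
have C0 : 0 < C.
  rewrite /C; have := @edge_energy_ge0 R M 1; move: (edge_energy R M 1) => E E0.
  have : 0 <= (2 * (2 * M).+1 ^ 2)%:R :> R by exact: ler0n.
  move: (_%:R : R) => W W0.
  have k1 : 0 < 16 / kap by exact: divr_gt0.
  have k2 : 0 <= (kap ^+ 2)^-1 by rewrite invr_ge0 exprn_ge0 // ltW.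
  have h1 : 0 <= 16 * E / kap ^+ 2 by rewrite !mulr_ge0.
  have h2 : 0 <= 1024 * W * E / kap ^+ 2.
    apply: mulr_ge0 k2; apply: mulr_ge0 E0; apply: mulr_ge0 W0; exact: ler0n.
  exact: ltr_wpDr h2 (ltr_wpDr h1 k1).
(* The exponent of [m * beta ^ (2 Q)] is negative: this is where [(1 + eps) / pi]
   beats the area of the half disc. *)
have expo : eps / 4 <= 2 * Q%:R * c - 1 / 2.
  have h1 : 2 * (pi / 4 * (1 - eta) * q%:R ^+ 2) * c <= 2 * Q%:R * c.
    by apply: ler_wpM2r; [exact: ltW|apply: ler_wpM2l; [|exact: hq]].
  have h2 : 2 * (pi / 4 * (1 - eta) * q%:R ^+ 2) * c =
      (1 - eta) ^+ 2 * (1 - 2 * eta) * (1 + eps) / 2.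
    rewrite /c /lam; move: (lt0r_neq0 pi0) (lt0r_neq0 qR); move: (pi : R) (q%:R : R) => p x p0 x0.
    by field; rewrite p0 x0.
  have h3 : (1 - 4 * eta) * (1 + eps) <= (1 - eta) ^+ 2 * (1 - 2 * eta) * (1 + eps).
    rewrite ler_pM2r //.
    have := sqr_ge0 eta; have : 0 <= eta ^+ 2 * (1 - eta) by rewrite mulr_ge0 ?sqr_ge0 //; lra.
    nra.
  lra.
exists C; split=> // d Omega P X PX delta delta0.
pose w := ((2 * M).+1 ^ 2)%N.
pose D : R := (w ^ (4 * Q) + 4 * M * w ^ (2 * Q) + 4 * M ^ 2 * w)%:R + 1.
have D0 : 0 < D by rewrite ltr_wpDl.
(* The union bound is at most [D * e]; the cap 1 allows the square of the side term to be bounded by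
   that term. *)
pose e := Num.min 1 (delta / D).
have e0 : 0 < e by rewrite lt_min ltr01 divr_gt0.
have [|L1 hL1] := @expR_ln_small R (2 * Q%:R * tau) (2 * Q%:R * c - 1 / 2) e _ e0; first by lra.
have [L2 hL2] := expR_ln_small tau c0 e0.
pose L4 : R := 4 * q%:R ^+ 2 * pi.
pose L5 : R := 2 * (2 * M%:R + 2 / eta) ^+ 2 * (1 + eps).
have [N hN] := ln_nat_ge (Num.max (Num.max 1 (Num.max L1 L2)) (Num.max L4 L5)).
exists N => n /hN; set L := ln n%:R; rewrite !ge_max.
move=> /andP[/and3P[l1 l2 l3] /andP[l4 l5]].
have n0 : (0 < n)%N.
  by rewrite lt0n; apply/eqP => n0; move: l1; rewrite /L n0 ln0 // leNgt ltr01.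
have nR : 0 < n%:R :> R by rewrite ltr0n.
have [r1 r2] := large_n heps eta0 l1 l4 l5.
have [m [m1 m2 m3 m4]] := grid_size eta1 q0 r1 r2.
have m0 : (0 < m)%N by apply: leq_ltn_trans m1.
pose K := (Num.truncn (kap * L)).+1.
have kL0 : 0 <= kap * L by rewrite mulr_ge0 ?ltW //; lra.
have kK : kap * L <= K%:R by apply: ltW; exact: truncnS_gt.
have Kk : K%:R <= kap * L + 1.
  by rewrite /K -natr1 lerD2r; have /andP[] := truncn_itv kL0.
pose beta := pois_lt (side R n m ^+ 2) K.
have beta0 : 0 <= beta by apply: pois_lt_ge0; exact: sqr_ge0.
have hlam : lam * L <= side R n m ^+ 2.
  apply: le_trans m4; rewrite expr_div_n (rgg_radius_sqr heps); last by rewrite -/L; lra.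
  rewrite -/L /lam le_eqVlt; apply/orP; left; apply/eqP.
  move: (lt0r_neq0 pi0) (lt0r_neq0 qR); move: (pi : R) (q%:R : R) => p x p0 x0.
  by field; rewrite p0 x0.
have hbeta : beta <= expR (tau - c * L).
  apply: (pois_lt_exp (lam := lam) eta1 (ltW lam0) _ hlam); first by lra.
  rewrite -/tau; apply: le_trans (ler_wpM2l (ltW tau0) Kk) _.
  rewrite mulrDr mulr1 lerD2r le_eqVlt; apply/orP; left; apply/eqP.
  by rewrite /kap; field; rewrite gt_eqF.
(* As [m] is at most sqrt n, it accounts for the [1 / 2] subtracted in the exponent. *)
have mL : m%:R <= expR (L / 2).
  apply: le_trans m3 _; rewrite -[leRHS]ger0_norm ?expR_ge0 // -sqrtr_sqr ler_wsqrtr //.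
  by rewrite -expRM_natl (_ : 2 * (L / 2) = L) ?lnK ?posrE //; field.
have mbeta : m%:R * beta ^+ (2 * Q) <= e.
  apply: le_trans (hL1 _ l2).
  have -> : 2 * Q%:R * tau - (2 * Q%:R * c - 1 / 2) * L = L / 2 + (2 * Q)%:R * (tau - c * L).
    by rewrite natrM; field.
  rewrite expRD expRM_natl; apply: ler_pM => //; first exact: exprn_ge0.
  by apply: lerXn2r => //; rewrite nnegrE ?expR_ge0.
have be : beta <= e by apply: le_trans hbeta (hL2 _ l3).
have e1 : e <= 1 by rewrite ge_min lexx.
have fail : (P n (bad_event n (X n) m q M K) <= delta%:E)%E.
  apply: le_trans (bad_event_le (PX n) _ _ m0 M0) _; rewrite lee_fin.
  apply: le_trans (union_bound_le _ _ beta0 be mbeta e1) _.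
  apply: (@le_trans _ _ (D * e)); first by apply: ler_wpM2r; [exact: ltW|rewrite /D lerDl].
  by rewrite mulrC -ler_pdivlMr // ge_min lexx orbT.
have mE : measurable (bad_event n (X n) m q M K) by exact: bad_event_measurable (PX n) m q M K.
exists (~` bad_event n (X n) m q M K); split.
- exact: measurableC.
- by rewrite probability_setC // EFinB; apply: leeB.
move=> omega nbad x y xV yV xy.
have [nb4 nb2 nb0] := not_bad_event m0 M0 nbad.
have [X1 _ _] := PX n; have [uV VL] := X1 omega.
have r0 : 0 <= rgg_radius eps n by exact: sqrtr_ge0.
have K0 : (0 < K)%N by [].
apply: le_trans (effres_cells q3 hM m1 K0 r0 m2 uV VL nb4 nb2 nb0 xV yV) _.
rewrite lee_fin; apply: total_energy_le => //.
apply: le_trans (harmonic_sum_ln R m0) _.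
have : ln m%:R <= L; last by lra.
rewrite ler_ln ?posrE ?ltr0n //; apply: le_trans m3 _.
by rewrite -[leRHS]ger0_norm // -sqrtr_sqr ler_wsqrtr // expr2 ler_peMl // ler1n.
Qed.
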